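(* Let $\beta>0$, let $\nu$ be a probability measure on $\mathbb{R}$ with finite second moment, $\int_{\mathbb{R}} x^2\,d\nu(x)<\infty$, and let $\mathbf{h}=(h_i)_{i\in\mathbb{N}}$ be i.i.d. random variables with marginal law $\nu$ and joint law $\mu=\nu^{\otimes\mathbb{N}}$. Let $m\in\mathbb{R}$ be a (local or global) minimum of $G$, of type $k\in\mathbb{N}$, $k\ge 1$, and strength $\lambda>0$, with height $h(m)$ and broadness $b(m)$, and suppose that $$\beta>\frac{2\,h(m)}{b(m)^2}.$$ Then, for $\mu$-almost every realization of $\mathbf{h}$, there exists $A=A(m)>0$ such that for all $0<a<A$ and every $\alpha$ with $1-\frac{1}{2(2k-1)}<\alpha<1$ the sequence of measures $$\left(P_{n,\beta}^{\mathbf{h}}\left(\frac{S_n-nm}{n^{\alpha}}\in\bullet\;\Big|\;\frac{S_n}{n}\in[m-a,m+a]\right)\right)_{n\in\mathbb{N}}$$ on $\mathbb{R}$ satisfies a moderate deviations principle with speed $n^{1-2k(1-\alpha)}$ and rate function $$I(x)=\begin{cases}\dfrac{x^2}{2\sigma^2}, & \text{if } k=1,\\[2mm] \dfrac{\lambda x^{2k}}{(2k)!}, & \text{if } k\ge 2,\end{cases}\qquad \text{where } \sigma^2=\lambda^{-1}-\beta^{-1}.$$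
   Context: Random field Curie-Weiss model: for a realization $\mathbf{h}=(h_i)_{i\in\mathbb{N}}$ of the random field and $n\in\mathbb{N}$, $P_{n,\beta}^{\mathbf{h}}$ is the probability measure on $\{-1,+1\}^n$ given by $$P_{n,\beta}^{\mathbf{h}}(\sigma)=\frac{1}{Z_{n,\beta}^{\mathbf{h}}}\exp\Big(\frac{\beta}{2n}\Big[\sum_{i=1}^n\sigma_i\Big]^2+\beta\sum_{i=1}^n h_i\sigma_i\Big),$$ where $Z_{n,\beta}^{\mathbf{h}}$ is the normalizing constant, and $S_n=\sum_{i=1}^n\sigma_i$. The function $G$: $G(x)=\frac{\beta}{2}x^2-\int_{\mathbb{R}}\ln\cosh[\beta(x+y)]\,d\nu(y)$ for $x\in\mathbb{R}$. A (local or global) minimum $m$ of $G$ is of type $k\in\mathbb{N}$ ($k\ge1$) and strength $\lambda>0$ if $G(x)=G(m)+\frac{\lambda}{(2k)!}(x-m)^{2k}+\mathcal{O}((x-m)^{2k+1})$ as $x\to m$. Height: $h(m)=G(m)-\inf_{w\in\mathbb{R}}G(w)\ge 0$. Broadness: $b(m)=\inf\{|y-m|: y\in\mathbb{R},\ G(y)<G(m)\}>0$, with $\inf\emptyset=+\infty$. If $m$ is a global minimum, then $h(m)=0$ and $b(m)=\infty$, and the condition $\beta>2h(m)/b(m)^2$ is regarded as trivially satisfied. Moderate deviations principle (technically the same as a large deviations principle): a sequence of measures $(\mu_n)_n$ on $\mathbb{R}$ satisfies it with speed $(a_n)_n$ and (good) rate function $I$ if $I$ is lower semicontinuous with compact level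 sets and for all Borel sets $C\subseteq\mathbb{R}$ $$-\inf_{x\in C^\circ}I(x)\le\liminf_{n\to\infty}\frac{1}{a_n}\ln\mu_n(C)\le\limsup_{n\to\infty}\frac{1}{a_n}\ln\mu_n(C)\le-\inf_{x\in\overline{C}}I(x).$$ *)

(* Defs.v *)
From HB Require Import structures.
From mathcomp Require Import all_boot all_order all_algebra.
From mathcomp Require Import all_classical all_reals all_analysis.

Set Implicit Arguments.
Unset Strict Implicit.
Unset Printing Implicit Defensive.

Import Order.TTheory GRing.Theory Num.Theory.
Import numFieldNormedType.Exports.

Local Open Scope classical_set_scope.
Local Open Scope ring_scope.

Section iid.
Context d (Omega : measurableType d) (R : realType) (P : probability Omega R).

Definition mutually_independent (X : nat -> {RV P >-> R}) : Prop :=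
  forall (J : seq nat) (A : nat -> set R),
    uniq J -> (forall i, i \in J -> measurable (A i)) ->
    P (\bigcap_(i in [set` J]) (X i @^-1` A i)) =
    (\prod_(i <- J) P (X i @^-1` A i))%E.

Definition iid_with_law (X : nat -> {RV P >-> R}) (nu : probability R R) : Prop :=
  mutually_independent X /\
  forall i (A : set R), measurable A -> distribution P (X i) A = nu A.

End iid.

Section large_deviations.
Context (R : realType).
Local Open Scope ereal_scope.

(* Large/moderate deviations principle with speed a and good rate function I;
   lne 0 = -oo. *)
Definition deviations_principle (mu : nat -> {measure set R -> \bar R})
    (a : nat -> R) (I : R -> \bar R) : Prop :=
  [/\ lower_semicontinuous I,
      forall c : R, compact [set x | I x <= c%:E] &
      forall C : set R, measurable C ->
        let u n := ((a n)^-1)%:E * lne (mu n C) in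
        [/\ - ereal_inf [set I x | x in C°] <= limn_einf u,
            limn_einf u <= limn_esup u &
            limn_esup u <= - ereal_inf [set I x | x in closure C]]].

End large_deviations.

(* C |-> P (X \in C | B); the zero measure when P B = 0. *)
Definition conditional_law d (T : measurableType d) (R : realType)
    (P : probability T R) (B : set T) (mB : measurable B) (X : {mfun T >-> R})
    (C : set R) : \bar R :=
  (P (X @^-1` C `&` B) * ((fine (P B))^-1)%:E)%E.

Section conditional_law_measure.
Context d (T : measurableType d) (R : realType).
Variables (P : probability T R) (B : set T) (mB : measurable B).
Variable X : {mfun T >-> R}.
Local Open Scope ereal_scope.
Local Notation law := (conditional_law P mB X).

Let conditional_law0 : law set0 = 0.
Proof. by rewrite /conditional_law preimage_set0 set0I measure0 mul0e. Qed.

Let conditional_law_ge0 C : 0 <= law C.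
Proof. by rewrite mule_ge0// lee_fin invr_ge0 fine_ge0. Qed.

Let conditional_law_sigma_additive : semi_sigma_additive law.
Proof.
move=> F mF tF mUF; rewrite /conditional_law.
have mX A : measurable A -> measurable (X @^-1` A).
  by move=> mA; rewrite -[X in measurable X]setTI; exact: measurable_funPT.
have mFX i : measurable (X @^-1` F i `&` B) by exact: measurableI (mX _ _) mB.
have c_ge0 : 0 <= ((fine (P B))^-1)%:E by rewrite lee_fin invr_ge0 fine_ge0.
rewrite (_ : (fun n => _) = fun n =>
    ((fine (P B))^-1)%:E * \sum_(0 <= i < n) P (X @^-1` F i `&` B)); last first.
  apply/funext => n; rewrite ge0_sume_distrr//.
  by apply: eq_bigr => i _; rewrite muleC.
rewrite [X in _ --> X](muleC (P _)).
apply: cvgeZl => //; rewrite preimage_bigcup setI_bigcupl.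
apply: measure_semi_sigma_additive => //.
- apply/trivIsetP => i j _ _ ij.
  by rewrite setIACA -preimage_setI ((trivIsetP.1 tF) i j)// preimage_set0 set0I.
- exact: bigcup_measurable.
Qed.

HB.instance Definition _ := isMeasure.Build _ _ _ law
  conditional_law0 conditional_law_ge0 conditional_law_sigma_additive.

End conditional_law_measure.

(* Spin configurations; true stands for the spin +1 and false for -1. *)
Definition config (n : nat) : Type := {ffun 'I_n -> bool}.

HB.instance Definition _ n := Finite.on (config n).
HB.instance Definition _ n := isPointed.Build (config n) [ffun=> true].
HB.instance Definition _ n := @isMeasurable.Build default_measure_display
  (config n) discrete_measurable discrete_measurable0
  discrete_measurableC discrete_measurableU.

Section random_field_curie_weiss.
Context (R : realType).

Definition spin (b : bool) : R := if b then 1 else -1.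

Definition magnetization n (s : config n) : R := \sum_(i < n) spin (s i).

(* The field is indexed from 0, so that site i < n feels h i. *)
Definition boltzmann (beta : R) (h : nat -> R) n (s : config n) : R :=
  expR (beta / (2 * n%:R) * magnetization s ^+ 2 +
        beta * \sum_(i < n) h i * spin (s i)).

Definition partition_function (beta : R) (h : nat -> R) n : R :=
  \sum_(s : config n) boltzmann beta h s.

Definition gibbs (beta : R) (h : nat -> R) n (A : set (config n)) : \bar R :=
  (\sum_(s : config n)
     (boltzmann beta h s / partition_function beta h n)%:E * \d_s A)%E.

Section gibbs_probability.
Variables (beta : R) (h : nat -> R) (n : nat).
Local Notation P := (@gibbs beta h n).

Lemma partition_function_gt0 : 0 < partition_function beta h n.
Proof.
rewrite /partition_function (bigD1 (point : config n))//=.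
by rewrite ltr_pwDl ?expR_gt0// sumr_ge0// => s _; exact: expR_ge0.
Qed.

Lemma gibbs_weight_ge0 (s : config n) :
  0 <= boltzmann beta h s / partition_function beta h n.
Proof. by rewrite divr_ge0 ?expR_ge0// ltW// partition_function_gt0. Qed.

Let gibbs0 : P set0 = 0%E.
Proof. by rewrite /gibbs big1// => s _; rewrite measure0 mule0. Qed.

Let gibbs_ge0 A : (0 <= P A)%E.
Proof. by apply: sume_ge0 => s _; rewrite mule_ge0// lee_fin gibbs_weight_ge0. Qed.

Let gibbs_sigma_additive : semi_sigma_additive P.
Proof.
move=> F mF tF mUF; rewrite /gibbs.
pose w (s : config n) : {nonneg R} := NngNum (gibbs_weight_ge0 s).
rewrite [X in _ --> X](_ : _ =
    lim ((fun m => \sum_(0 <= i < m) P (F i))%E @ \oo)).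
  by apply: is_cvg_ereal_nneg_natsum => k _; exact: gibbs_ge0.
rewrite /gibbs nneseries_sum; last first.
  by move=> s i _; exact: (measure_ge0 (mscale (w s) \d_s) (F i)).
apply: eq_bigr => /= s _.
exact: (measure_semi_bigcup (mscale (w s) \d_s)).
Qed.

HB.instance Definition _ := isMeasure.Build _ _ _ P
  gibbs0 gibbs_ge0 gibbs_sigma_additive.

Let gibbsT : P [set: config n] = 1%E.
Proof.
rewrite /gibbs; under eq_bigr do rewrite diracT mule1.
rewrite sumEFin -mulr_suml -/(partition_function _ _ _) divff//.
by rewrite gt_eqF// partition_function_gt0.
Qed.

HB.instance Definition _ := Measure_isProbability.Build _ _ _ P gibbsT.

End gibbs_probability.

Section rescaled_magnetization.
Variables (m alpha : R) (n : nat).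

Definition rescaled_magnetization (s : config n) : R :=
  (magnetization s - n%:R * m) / n%:R `^ alpha.

Let measurable_rescaled_magnetization :
  measurable_fun [set: config n] rescaled_magnetization.
Proof. by []. Qed.

HB.instance Definition _ := isMeasurableFun.Build _ _ _ _
  rescaled_magnetization measurable_rescaled_magnetization.

End rescaled_magnetization.

Definition mean_magnetization_near (m a : R) n : set (config n) :=
  [set s | magnetization s / n%:R \in `[m - a, m + a]].

Lemma measurable_mean_magnetization_near m a n :
  measurable (@mean_magnetization_near m a n).
Proof. by []. Qed.

Definition conditioned_law (beta : R) (h : nat -> R) (m alpha a : R) (n : nat)
    : {measure set R -> \bar R} :=
  conditional_law (@gibbs beta h n)
    (measurable_mean_magnetization_near m a n)
    (@rescaled_magnetization m alpha n).

Definition cosh (x : R) : R := (expR x + expR (- x)) / 2.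

Definition free_energy (beta : R) (nu : probability R R) (x : R) : R :=
  beta / 2 * x ^+ 2 - \int[nu]_y ln (cosh (beta * (x + y))).

(* Local minimum (global ones included) of type k and strength lambda. *)
Definition minimum_of_type (G : R -> R) (m : R) (k : nat) (lambda : R) : Prop :=
  [/\ \forall x \near m, G m <= G x,
      (1 <= k)%N,
      0 < lambda &
      forall x, G x = G m + lambda / ((2 * k)`!)%:R * (x - m) ^+ (2 * k)
                  +O_(x \near m) ((x - m) ^+ (2 * k).+1)].

Definition height (G : R -> R) (m : R) : R := G m - inf (range G).

Definition broadness (G : R -> R) (m : R) : \bar R :=
  ereal_inf [set `|y - m|%:E | y in [set y | G y < G m]].

Definition rate (beta : R) (k : nat) (lambda x : R) : R :=
  let sigma2 := lambda^-1 - beta^-1 in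
  if k == 1%N then x ^+ 2 / (2 * sigma2)
  else lambda * x ^+ (2 * k) / ((2 * k)`!)%:R.

End random_field_curie_weiss.

(* Main.v *)
(* Let [G_n x = beta / 2 * x^2 - 1/n * sum_i ln cosh (beta * (x + h_i))] be the
   empirical version of [G] and let [q_x] be the law of independent spins in the
   fields [x + h_i]. Completing the square gives, for every [x],
   [boltzmann s = 2^n * exp (n * (beta / 2 * (S/n - x)^2 - G_n x)) * q_x s].
   Bounding [q_x] by 1, with [x] chosen as a function of [S/n], gives the upper
   bound, since [S/n] takes only [n + 1] values. Choosing [x] so that the mean of
   [S/n] under [q_x] is the target value gives the lower bound, the concentration
   of [q_x] being itself read off the identity above for two neighbouring values
   of [x]. Almost surely [G_n (m + t) - G_n m] differs from [G (m + t) - G m] by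
   [O (|t| * sqrt (ln n / n) + 1/n)] uniformly in [|t| <= 1] (exponential Markov
   inequality on a grid and Borel-Cantelli), which is negligible on the scale
   [t ~ n^(alpha - 1)] exactly when [alpha > 1 - 1 / (2 * (2 * k - 1))]. *)

Require Import Defs.
From HB Require Import structures.
From mathcomp Require Import all_boot all_order all_algebra.
From mathcomp Require Import all_classical all_reals all_analysis.
From mathcomp Require Import measurable_realfun.
From mathcomp Require Import ring lra zify.

Set Implicit Arguments.
Unset Strict Implicit.
Unset Printing Implicit Defensive.

Import Order.TTheory GRing.Theory Num.Theory.
Import numFieldNormedType.Exports.

Local Open Scope classical_set_scope.
Local Open Scope ring_scope.

(** A finite second moment need not give [ln cosh (beta * (x + h_i))] any exponential moment. Its
    increment from [x = m] to [x = m + t], however, is bounded by [beta * |t|] whatever the field.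
    Hence only increments of the empirical energy are estimated: its value at [m] cancels between
    numerator and denominator of the conditional law, and the factor [|t|] in the error decides the
    range of [alpha]. All that follows is deterministic, for one realization that obeys the
    resulting expansion of [G_n] at [m].

    The rate comes from balancing the square against the energy. With [S/n] at distance [x] and the
    tilt at distance [u] from [m], both on the scale [n^(alpha - 1)], the square has speed
    [n^(2 alpha - 1)] and the energy speed [n^(1 - 2k(1 - alpha))]. For [k = 1] the speeds agree and
    the best tilt is [u = beta x / (beta - lambda)], which turns [lambda] into [1 / sigma^2]; this
    needs [lambda < beta], a consequence of the strict convexity of [ln cosh]. For [k >= 2] the
    square dominates and forces [u = x]. *)

Section auxiliary.
Variable R : realType.

Lemma normrX_even (x : R) k : `|x| ^+ (2 * k) = x ^+ (2 * k).
Proof. by rewrite !exprM real_normK// num_real. Qed.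

Lemma ler_norm_exprn_even (x : R) k : (1 <= k)%N -> 1 <= `|x| ->
  `|x| <= x ^+ (2 * k).
Proof.
by move=> k1 x1; rewrite -normrX_even -[leLHS]expr1 ler_weXn2l// muln_gt0.
Qed.

Lemma Rintegral_cst_probability (nu : probability R R) (c : R) :
  \int[nu]_y cst c y = c.
Proof. by rewrite Rintegral_cst// [X in fine X](probability_setT nu) mulr1. Qed.

Lemma bounded_integrable_probability (nu : probability R R) (f : R -> R) (K : R) :
    measurable_fun setT f -> (forall y, `|f y| <= K) ->
  nu.-integrable setT (EFin \o f).
Proof.
move=> mf fK; apply: measurable_bounded_integrable => //.
  by rewrite ltey_eq fin_num_measure.
exists K; split; first exact: num_real.
by move=> z Kz y _ /=; rewrite (le_trans (fK y))// ltW.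
Qed.

End auxiliary.

(** * Exponential tilting *)

Section tilting.
Variable R : realType.
Implicit Types (beta x y u eta : R) (h : nat -> R) (n : nat).

Lemma cosh_gt0 (x : R) : 0 < cosh x.
Proof. by rewrite /cosh divr_gt0// addr_gt0// expR_gt0. Qed.

Definition empirical_energy beta h n x : R :=
  beta / 2 * x ^+ 2 - n%:R^-1 * \sum_(i < n) ln (cosh (beta * (x + h i))).

(* The law of independent spins in the fields [x + h i]: it is the Gibbs
   measure with the interaction linearised at mean magnetization [x]. *)
Definition tilted_weight beta h n x (s : config n) : R :=
  \prod_(i < n)
    (expR (beta * (x + h i) * spin R (s i)) / (2 * cosh (beta * (x + h i)))).

Definition mean_magnetization n (s : config n) : R := magnetization R s / n%:R.

Lemma tilted_weight_ge0 beta h n x (s : config n) : 0 <= tilted_weight beta h x s.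
Proof.
apply: prodr_ge0 => i _; rewrite divr_ge0 ?expR_ge0// mulr_ge0//.
exact/ltW/cosh_gt0.
Qed.

Lemma sum_tilted_weight beta h n x :
  \sum_(s : config n) tilted_weight beta h x s = 1.
Proof.
rewrite /tilted_weight -(bigA_distr_bigA (fun (i : 'I_n) (b : bool) =>
  expR (beta * (x + h i) * spin R b) / (2 * cosh (beta * (x + h i))))).
apply: big1 => i _; rewrite big_bool/= /spin mulr1 mulrN1.
have := cosh_gt0 (beta * (x + h i)); rewrite /cosh.
set p := expR _; set q := expR _ => pq.
by field; lra.
Qed.

Lemma boltzmann_tilted beta h n x (s : config n) : (0 < n)%N ->
  boltzmann beta h s = 2 ^+ n *
    expR (n%:R * (beta / 2 * (mean_magnetization s - x) ^+ 2 -
                  empirical_energy beta h n x)) *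
    tilted_weight beta h x s.
Proof.
move=> n0; have nn0 : (n%:R : R) != 0 by rewrite pnatr_eq0 -lt0n.
rewrite /tilted_weight big_split/= prodfV -expR_sum.
have -> : \prod_(i < n) (2 * cosh (beta * (x + h i))) =
    2 ^+ n * expR (\sum_(i < n) ln (cosh (beta * (x + h i)))).
  rewrite big_split/= prodr_const card_ord expR_sum; congr (_ * _).
  by apply: eq_bigr => i _; rewrite lnK// posrE cosh_gt0.
rewrite invfM -expRN.
rewrite [expR (\sum_(i < n) _) * _]mulrCA mulrACA divff ?expf_neq0// mul1r.
rewrite -!expRD /boltzmann.
congr expR; rewrite /empirical_energy /mean_magnetization.
have -> : \sum_(i < n) beta * (x + h i) * spin R (s i) =
    beta * x * magnetization R s + beta * \sum_(i < n) h i * spin R (s i).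
  rewrite /magnetization !mulr_sumr -big_split/=; apply: eq_bigr => i _; ring.
by field.
Qed.

(** [boltzmann_tilted] at [x] and at [x + u] expresses the same Boltzmann weight twice. The squares
    of the mean magnetization cancel, so the density is the exponential of an affine function of
    it. *)
Lemma tilted_weight_change beta h n x u (s : config n) : (0 < n)%N ->
  tilted_weight beta h x s =
    expR (n%:R * (beta / 2 * (u ^+ 2 - 2 * u * (mean_magnetization s - x)) +
      empirical_energy beta h n x - empirical_energy beta h n (x + u))) *
    tilted_weight beta h (x + u) s.
Proof.
move=> n0; have nz : 2 ^+ n * expR (n%:R * (beta / 2 *
    (mean_magnetization s - x) ^+ 2 - empirical_energy beta h n x)) != 0.
  by rewrite mulf_neq0 ?expf_neq0// gt_eqF// expR_gt0.
apply: (mulfI nz); rewrite -(boltzmann_tilted beta h x s n0).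
rewrite (boltzmann_tilted beta h (x + u) s n0) [RHS]mulrA; congr (_ * _).
rewrite -[RHS]mulrA -expRD; congr (_ * expR _).
move: (mean_magnetization s) (empirical_energy _ _ _ _) (empirical_energy _ _ _ _).
move=> y E E'; ring.
Qed.

(** On [B] the density of the law tilted at [x] with respect to the law tilted at [x + u] is at most
    the right-hand side, and the latter law has mass 1. *)
Lemma sum_tilted_weight_deviation beta h n x u D (B : pred (config n)) :
    (0 < n)%N -> 0 <= beta ->
    (forall s, B s -> D <= u * (mean_magnetization s - x)) ->
  \sum_(s : config n | B s) tilted_weight beta h x s <=
    expR (n%:R * (beta / 2 * (u ^+ 2 - 2 * D) +
      empirical_energy beta h n x - empirical_energy beta h n (x + u))).
Proof.
move=> n0 beta0 BD; set E := expR _.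
have -> : E = \sum_(s : config n) E * tilted_weight beta h (x + u) s.
  by rewrite -mulr_sumr sum_tilted_weight mulr1.
rewrite [leRHS](bigID B)/=; apply: ler_wpDr.
  by apply: sumr_ge0 => s _; rewrite mulr_ge0 ?expR_ge0 ?tilted_weight_ge0.
apply: ler_sum => s Bs; rewrite (tilted_weight_change _ _ _ u s n0).
rewrite ler_wpM2r ?tilted_weight_ge0// ler_expR ler_wpM2l// lerB// lerD2r.
by rewrite ler_wpM2l ?divr_ge0// -mulrA lerB// ler_pM2l// BD.
Qed.

(* [mean_magnetization] takes at most [n + 1] values, and the tilt may be chosen
   separately for each of them. *)
Lemma sum_boltzmann_le beta h n (B : pred (config n)) (tau : R -> R) (E : R) :
    (0 < n)%N ->
    (forall s, B s -> let y := mean_magnetization s in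
      n%:R * (beta / 2 * (y - tau y) ^+ 2 -
              empirical_energy beta h n (tau y)) <= E) ->
  \sum_(s : config n | B s) boltzmann beta h s <= 2 ^+ n * n.+1%:R * expR E.
Proof.
move=> n0 BE.
(* The number of spins [+1] determines the mean magnetization and serves as its index among [n + 1]
   values. *)
pose plus (s : config n) : 'I_n.+1 := inord #|[set i | s i]|%SET.
have card_plus (s : config n) : (#|[set i | s i]%SET| < n.+1)%N.
  by rewrite ltnS (leq_trans (max_card _))// card_ord.
have magE (s : config n) : mean_magnetization s = (2 * (plus s)%:R - n%:R) / n%:R.
  rewrite /mean_magnetization; congr (_ / _).
  rewrite inordK// /magnetization (bigID (fun i => s i))/=.
  rewrite (eq_bigr (fun=> 1)) => [|i ->//].
  rewrite [X in _ + X](eq_bigr (fun=> -1)) => [|i /negbTE ->//].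
  rewrite !sumr_const mulNrn.
  have := cardC (fun i => s i); rewrite card_ord.
  rewrite cardsE => /(congr1 (fun k => k%:R : R)); rewrite natrD => <-.
  have -> : #|[predC (fun i => s i)]| = #|(fun i => ~~ s i)| by apply: eq_card.
  ring.
rewrite (partition_big plus xpredT)//=.
have -> : 2 ^+ n * n.+1%:R * expR E = \sum_(j < n.+1) 2 ^+ n * expR E.
  by rewrite sumr_const card_ord -mulr_natr; ring.
apply: ler_sum => j _.
have [/existsP[s0 /andP[Bs0 /eqP s0j]]|/existsPn noB] :=
    boolP [exists s, B s && (plus s == j)]; last first.
  by rewrite big_pred0 ?mulr_ge0 ?exprn_ge0 ?expR_ge0// => s; exact/negbTE/noB.
(* All configurations of the class share the mean magnetization of the representative [s0], hence
   also its tilt, so a single tilted law of mass 1 bounds the class. *)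
set t := tau (mean_magnetization s0).
have -> : 2 ^+ n * expR E =
    \sum_(s : config n) 2 ^+ n * expR E * tilted_weight beta h t s.
  by rewrite -mulr_sumr sum_tilted_weight mulr1.
rewrite [leRHS](bigID (fun s => B s && (plus s == j)))/=; apply: ler_wpDr.
  apply: sumr_ge0 => s _.
  by rewrite mulr_ge0 ?tilted_weight_ge0// mulr_ge0 ?exprn_ge0 ?expR_ge0.
apply: ler_sum => s /andP[Bs /eqP sj].
have ss0 : mean_magnetization s = mean_magnetization s0 by rewrite !magE sj s0j.
rewrite (boltzmann_tilted beta h t s n0) ler_wpM2r ?tilted_weight_ge0//.
by rewrite ler_wpM2l ?exprn_ge0// ler_expR /t -ss0; exact: BE.
Qed.

(** The bound of [sum_tilted_weight_deviation] for the half-line that starts at [y + u] and points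
    away from [y], where [D = u * (y + u - x)]. The sign of [u] selects the side. *)
Definition deviation_bound beta h n x y u : R :=
  expR (n%:R * (beta / 2 * (- u ^+ 2 - 2 * u * (y - x)) +
    empirical_energy beta h n x - empirical_energy beta h n (x + u))).

(* With [y] close to the mean of the law tilted at [x], both deviation terms are
   small. *)
Lemma sum_boltzmann_ge beta h n (B : pred (config n)) x y eta D :
    (0 < n)%N -> 0 <= beta -> 0 <= eta ->
    (forall s, `|mean_magnetization s - y| < eta ->
       B s /\ D <= (mean_magnetization s - x) ^+ 2) ->
  2 ^+ n * expR (n%:R * (beta / 2 * D - empirical_energy beta h n x)) *
    (1 - deviation_bound beta h n x y eta - deviation_bound beta h n x y (- eta)) <=
  \sum_(s : config n | B s) boltzmann beta h s.
Proof.
move=> n0 beta0 eta0 near_y.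
pose near (s : config n) := `|mean_magnetization s - y| < eta.
apply: (@le_trans _ _ (\sum_(s : config n | near s) boltzmann beta h s)); last first.
  rewrite [leRHS](bigID near)/=; apply: ler_wpDr.
    by apply: sumr_ge0 => s _; exact: expR_ge0.
  rewrite [leLHS](eq_bigl (fun s => B s && near s))// => s.
  by have [/near_y[->]|] := boolP (near s); rewrite ?andbF.
apply: (@le_trans _ _ (\sum_(s : config n | near s)
    2 ^+ n * expR (n%:R * (beta / 2 * D - empirical_energy beta h n x)) *
      tilted_weight beta h x s)); last first.
  apply: ler_sum => s /near_y[_ Ds]; rewrite (boltzmann_tilted beta h x s n0).
  rewrite ler_wpM2r ?tilted_weight_ge0// ler_wpM2l ?exprn_ge0// ler_expR.
  by rewrite ler_wpM2l// lerB// ler_wpM2l// divr_ge0.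
rewrite -mulr_sumr ler_wpM2l ?mulr_ge0 ?exprn_ge0 ?expR_ge0//.
(* The 1 becomes the total tilted mass; what lies outside the window splits into the two half-lines
   beyond [y + eta] and [y - eta]. *)
rewrite -[X in X - _ - _](sum_tilted_weight beta h n x) (bigID near)/=.
rewrite -addrA -opprD lerBlDr lerD2l.
rewrite (bigID (fun s => y <= mean_magnetization s))/=.
apply: lerD.
  apply: (le_trans (sum_tilted_weight_deviation (u := eta)
    (D := eta * (y + eta - x)) h n0 beta0 _)).
    move=> s /andP[+ ys]; rewrite /near -leNgt ger0_norm ?subr_ge0// => s_far.
    by rewrite ler_wpM2l//; lra.
  by rewrite le_eqVlt; apply/orP; left; apply/eqP; congr (expR (_ * _)); ring.
apply: (le_trans (sum_tilted_weight_deviation (u := - eta)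
  (D := - eta * (y - eta - x)) h n0 beta0 _)).
  move=> s /andP[+ ys]; rewrite -ltNge in ys.
  rewrite /near -leNgt ltr0_norm ?subr_lt0// => s_far.
  by rewrite !mulNr lerN2 ler_wpM2l//; lra.
by rewrite le_eqVlt; apply/orP; left; apply/eqP; congr (expR (_ * _)); ring.
Qed.

End tilting.

(** * Independence and exponential moments *)

Section independence.
Local Open Scope ereal_scope.
Context d (T : measurableType d) (R : realType).
Import HBNNSimple.

(** Linearity extends the identity from indicators to simple functions, and monotone convergence to
    nonnegative measurable [f]. In the application [Y] is a product of functions of the other
    variables and [c] is its mean. *)
Lemma ge0_integral_mul_comp (P : {measure set T -> \bar R})
    (nu : {measure set R -> \bar R}) (Y X : T -> R) (c : R) (f : R -> R) :
    measurable_fun setT Y -> measurable_fun setT X -> (forall w, 0 <= Y w)%R ->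
    (0 <= c)%R ->
    (forall A : set R, measurable A ->
      \int[P]_w (Y w * \1_A (X w))%:E = c%:E * nu A) ->
    measurable_fun setT f -> (forall y, 0 <= f y)%R ->
  \int[P]_w (Y w * f (X w))%:E = c%:E * \int[nu]_y (f y)%:E.
Proof.
move=> mY mX Y0 c0 YA mf f0.
have mEf : measurable_fun [set: R] (EFin \o f) by exact/measurable_EFinP.
pose g := nnsfun_approx measurableT mEf.
have g_cvg y : (g n y)%:E @[n --> \oo] --> (f y)%:E.
  by apply: (cvg_nnsfun_approx measurableT mEf) => // x _; rewrite lee_fin.
have g_nd y : {homo (fun n => g n y) : a b / (a <= b)%N >-> (a <= b)%R}.
  by move=> a b ab; exact/lefP/nd_nnsfun_approx.
have mgX n : measurable_fun setT (fun w => g n (X w)).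
  by apply: measurableT_comp => //; exact: measurable_funP.
have mYindic k n :
    measurable_fun setT (fun w => (Y w * \1_(g n @^-1` [set k]) (X w))%R).
  by apply: measurable_funM => //; exact: measurableT_comp.
have nnsfun_case n :
    \int[P]_w (Y w * g n (X w))%:E = c%:E * \int[nu]_y (g n y)%:E.
  rewrite integralT_nnsfun sintegralE ge0_mule_fsumr; last first.
    by move=> k; exact: nnsfun_mulemu_ge0.
  transitivity (\int[P]_w (\sum_(k \in range (g n))
      k%:E * (Y w * \1_(g n @^-1` [set k]) (X w))%:E)).
    apply: eq_integral => w _.
    rewrite {1}fimfunE EFinM -fsumEFin// ge0_mule_fsumr; last first.
      by move=> k; exact: nnfun_muleindic_ge0.
    by apply: eq_fsbigr => k _; rewrite -!EFinM mulrCA.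
  have kY0 k w : 0 <= k%:E * (Y w * \1_(g n @^-1` [set k]) (X w))%:E.
    rewrite EFinM muleCA mule_ge0 ?lee_fin//.
    exact: (nnfun_muleindic_ge0 (g n) k (X w)).
  rewrite ge0_integral_fsum//; last first.
    by move=> k; apply/measurable_EFinP/measurable_funM.
  apply: eq_fsbigr => k; rewrite inE => -[y _ yk].
  rewrite ge0_integralZl_EFin//.
  - by rewrite YA// muleCA.
  - by move=> w _; rewrite lee_fin mulr_ge0.
  - exact/measurable_EFinP.
  - by rewrite -yk.
transitivity (limn (fun n => \int[P]_w (Y w * g n (X w))%:E)).
  rewrite -monotone_convergence//.
  - apply: eq_integral => w _; apply/esym/cvg_lim => //.
    under eq_fun do rewrite EFinM.
    by rewrite EFinM; apply: cvgeZl => //; exact: g_cvg.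
  - by move=> n; apply/measurable_EFinP/measurable_funM.
  - by move=> n w _; rewrite lee_fin mulr_ge0.
  - by move=> w _ a b ab; rewrite lee_fin ler_wpM2l//; exact: g_nd.
under eq_fun do rewrite nnsfun_case.
rewrite limeMl//; last first.
  apply/cvg_ex; eexists; apply: cvg_monotone_convergence => //.
  - by move=> n; exact/measurable_EFinP/measurable_funP.
  - by move=> n y _; rewrite lee_fin.
  - by move=> y _ a b ab; rewrite lee_fin; exact: g_nd.
rewrite -monotone_convergence//.
- congr (_ * _); apply: eq_integral => y _; exact/cvg_lim.
- by move=> n; exact/measurable_EFinP/measurable_funP.
- by move=> n y _; rewrite lee_fin.
- by move=> y _ a b ab; rewrite lee_fin; exact: g_nd.
Qed.

(* The test functions are replaced one at a time: as long as [g i] is an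
   indicator for all [i >= j], mutual independence applies to it. *)
Lemma integral_prod_iid (P : probability T R) (nu : probability R R)
    (X : nat -> {RV P >-> R}) n (f : nat -> R -> R) :
    iid_with_law X nu ->
    (forall i, measurable_fun setT (f i)) -> (forall i y, 0 <= f i y)%R ->
    (forall i, \int[nu]_y (f i y)%:E < +oo) ->
  \int[P]_w (\prod_(i < n) f i (X i w))%:E =
  \prod_(i < n) \int[nu]_y (f i y)%:E.
Proof.
move=> [indep law] mf f0 fy.
suff main j (g : nat -> R -> R) : (forall i, measurable_fun setT (g i)) ->
    (forall i y, 0 <= g i y)%R -> (forall i, \int[nu]_y (g i y)%:E < +oo) ->
    (forall i, (j <= i < n)%N -> exists2 A, measurable A & g i = \1_A) ->
    \int[P]_w (\prod_(i < n) g i (X i w))%:E =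
    \prod_(i < n) \int[nu]_y (g i y)%:E.
  by apply: (main n) => // i /andP[/leq_ltn_trans /[apply]]; rewrite ltnn.
elim: j g => [|j IHj] g mg g0 gy gA.
  (* A function equal to an indicator is recovered as that of its level set at 1. The default [set0]
     covers indices outside the product. *)
  pose A i := if (i < n)%N then g i @^-1` [set 1%R] else set0.
  have gE i : (i < n)%N -> measurable (A i) /\ g i = \1_(A i).
    move=> ilt; rewrite /A ilt; have [|B mB ->] := gA i; first by rewrite ilt.
    suff -> : \1_B @^-1` [set (1 : R)%R] = B by [].
    apply/seteqP; split => y /=; rewrite indicE; last by move=> ?; rewrite mem_set.
    by case: (boolP (y \in B)) => [/set_mem//|_ /esym /eqP]; rewrite oner_eq0.
  have mA i : (i < n)%N -> measurable (A i) by move=> /gE[].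
  have := indep (iota 0 n) A (iota_uniq 0 n).
  have iota_lt i : i \in iota 0 n -> (i < n)%N by rewrite mem_iota.
  move=> /(_ (fun i inn => mA i (iota_lt i inn))) E.
  set S := \bigcap_(i in _) _ in E.
  have mS : measurable S.
    apply: bigcap_measurableType => i /iota_lt ilt.
    have mAi := mA i ilt.
    by rewrite -[X in measurable X]setTI; exact: measurable_funPT.
  have iotaS (i : 'I_n) : (i : nat) \in iota 0 n by rewrite mem_iota ltn_ord.
  transitivity (P S).
    rewrite -[S]setIT -integral_indic//; apply: eq_integral => w _; congr EFin.
    have [Sw|Sw] := pselect (S w).
      rewrite indicE mem_set// big1// => i _; have [_ ->] := gE i (ltn_ord i).
      by rewrite indicE mem_set//; exact: (Sw i (iotaS i)).
    rewrite indicE memNset//; move: Sw => /existsNP[i /not_implyP[/= /iota_lt ilt XA]].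
    rewrite (bigD1 (Ordinal ilt))//=; have [_ ->] := gE i ilt.
    by rewrite indicE memNset// mul0r.
  rewrite E (_ : iota 0 n = index_iota 0 n); last by rewrite /index_iota subn0.
  rewrite big_mkord.
  apply: eq_bigr => i _; have [mAi ->] := gE i (ltn_ord i).
  by rewrite integral_indic// setIT; exact: law.
(* The product stops at [n], so for [n <= j] the function [g j] does not occur in it. *)
have [nj|jn] := leqP n j.
  apply: IHj => // i /andP[ji ilt].
  by have := leq_ltn_trans ji ilt; rewrite ltnNge nj.
pose J := Ordinal jn.
(* With an indicator in place [j], the induction hypothesis computes the integral. This is the
   assumption of [ge0_integral_mul_comp], which then restores [g j]. *)
pose g_ B i := if i == j then \1_B else g i.
have gfin i : \int[nu]_y (g i y)%:E \is a fin_num.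
  by rewrite ge0_fin_numE// integral_ge0// => y _; rewrite lee_fin.
pose c := (\prod_(i < n | i != J) fine (\int[nu]_y (g i y)%:E))%R.
have cE : c%:E = \prod_(i < n | i != J) \int[nu]_y (g i y)%:E.
  by rewrite /c -prodEFin; apply: eq_bigr => i _; rewrite fineK.
rewrite (bigD1 J)//= muleC -cE.
under eq_integral do rewrite (bigD1 J)//= mulrC.
apply: (@ge0_integral_mul_comp P nu _ (X j) c (g j)) => //.
- under eq_fun do rewrite -big_filter.
  by apply: measurable_prod => i _; apply: measurableT_comp.
- by move=> w; exact: prodr_ge0.
- by apply: prodr_ge0 => i _; rewrite fine_ge0// integral_ge0// => y _; rewrite lee_fin.
move=> B mB; have gj : g_ B J = \1_B by rewrite /g_ eqxx.
have gi (i : 'I_n) : i != J -> g_ B i = g i.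
  by move=> ij; rewrite /g_ (_ : (i : nat) == j = false)//; exact/negbTE.
transitivity (\int[P]_w (\prod_(i < n) g_ B i (X i w))%:E).
  apply: eq_integral => w _; congr EFin.
  rewrite [in RHS](bigD1 J)//= gj [RHS]mulrC; congr (_ * _)%R.
  by apply: eq_bigr => i /gi ->.
rewrite IHj.
- rewrite (bigD1 J)//= gj integral_indic// setIT muleC cE; congr (_ * _).
  by apply: eq_bigr => i /gi ->.
- by move=> i; rewrite /g_; case: ifP => // _; exact: measurable_indic.
- by move=> i y; rewrite /g_; case: ifP.
- move=> i; rewrite /g_; case: ifP => // _; rewrite integral_indic// setIT.
  by rewrite -ge0_fin_numE// fin_num_measure.
- move=> i /andP[ji ilt]; rewrite /g_; case: eqP => [_|/eqP ij]; first by exists B.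
  by apply: gA; rewrite ilt ltn_neqAle eq_sym ij ji.
Qed.

End independence.

(** * Exponential concentration for bounded functions of i.i.d. variables *)

Section concentration.
Variable R : realType.

(** Inverting [1 - s <= expR (- s)] gives [expR s <= 1 / (1 - s)], and [(1 + s + 2 s^2) (1 - s) = 1
    + s^2 (1 - 2 s)]. *)
Lemma expR_le_quadratic (s : R) : s <= 1 / 2 -> expR s <= 1 + s + 2 * s ^+ 2.
Proof.
move=> s12; have s1 : 0 < 1 - s by lra.
have : 1 - s <= expR (- s) by have := expR_ge1Dx (- s); lra.
rewrite expRN -[leLHS]invrK lef_pV2 ?posrE ?invr_gt0// ?expR_gt0// => /le_trans; apply.
rewrite -[leLHS]mul1r ler_pdivrMr//.
have : 0 <= s ^+ 2 * (1 - 2 * s) by rewrite mulr_ge0 ?sqr_ge0//; lra.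
by nra.
Qed.

(** Each exponential in [cosh c] is at most [expR |c - e|] times the corresponding one in
    [cosh e]. *)
Lemma ln_cosh_lipschitz (a b : R) : `|ln (cosh a) - ln (cosh b)| <= `|a - b|.
Proof.
suff main c e : ln (cosh c) - ln (cosh e) <= `|c - e| :> R.
  by rewrite ler_norml main andbT lerNl opprB distrC main.
rewrite lerBlDr -ler_expR expRD !lnK ?posrE ?cosh_gt0// /cosh mulrA mulrDr.
rewrite ler_wpM2r// lerD// -expRD ler_expR.
  by have := ler_norm (c - e); lra.
by have := ler_norm (- (c - e)); rewrite normrN; lra.
Qed.

Lemma measurable_ln_cosh (beta x : R) :
  measurable_fun [set: R] (fun y : R => ln (cosh (beta * (x + y)))).
Proof.
apply: measurableT_comp; first exact: measurable_ln.
rewrite /cosh; apply: measurable_funM => //; apply: measurable_funD.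
  apply: measurableT_comp; first exact: measurable_expR.
  by apply: measurable_funM => //; apply: measurable_funD.
apply: measurableT_comp; first exact: measurable_expR.
by apply: measurableT_comp => //; apply: measurable_funM => //; apply: measurable_funD.
Qed.

(** [ln cosh] vanishes at 0 and is 1-Lipschitz, so it grows at most linearly; [|y| <= 1 + y^2] then
    brings in the second moment. *)
Lemma integrable_ln_cosh (nu : probability R R) (beta x : R) :
    (\int[nu]_x (x ^+ 2)%:E < +oo)%E ->
  nu.-integrable setT (EFin \o (fun y : R => ln (cosh (beta * (x + y))))).
Proof.
move=> nu2.
have i2 : nu.-integrable setT (EFin \o (fun y : R => y ^+ 2)).
  apply/integrableP; split; first by apply/measurable_EFinP; exact: exprn_measurable.
  by under eq_integral do rewrite /= ger0_norm ?sqr_ge0//.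
have i1 : nu.-integrable setT (EFin \o cst (`|beta| * (`|x| + 1))).
  exact: finite_measure_integrable_cst.
have i3 := integrableD measurableT i1 (integrableZl measurableT `|beta| i2).
apply: le_integrable i3 => //; first by apply/measurable_EFinP; exact: measurable_ln_cosh.
move=> y _ /=; rewrite lee_fin.
have := ln_cosh_lipschitz (beta * (x + y)) 0.
rewrite {2}/cosh oppr0 expR0 divff ?pnatr_eq0// ln1 !subr0 => /le_trans; apply.
rewrite [leRHS]ger0_norm; last first.
  by apply: addr_ge0; apply: mulr_ge0; rewrite ?sqr_ge0 ?addr_ge0.
rewrite addr0 normrM -mulrDr ler_wpM2l// (le_trans (ler_normD _ _))//.
rewrite -addrA lerD2l -(real_normK (num_real y)).
by have := sqr_ge0 (`|y| - 1); have := normr_ge0 y; nra.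
Qed.

Lemma measurable_sum_ge d (T : measurableType d) (P : probability T R)
    (X : nat -> {RV P >-> R}) (psi : R -> R) (n : nat) (e a : R) :
    measurable_fun setT psi ->
  measurable [set w | a <= \sum_(i < n) (psi (X i w) - e)].
Proof.
move=> mpsi; have mX : measurable_fun setT (fun w => \sum_(i < n) (psi (X i w) - e)).
  apply: measurable_sum => i; apply: measurable_funB => //.
  by apply: measurableT_comp.
have := measurable_fun_ler (measurable_cst a) mX.
move=> /(_ measurableT [set true]) mA.
rewrite (_ : [set w | _] = setT `&`
  (fun w => a <= \sum_(i < n) (psi (X i w) - e)) @^-1` [set true]); first exact: mA.
by apply/seteqP; split => w /=; [split|case].
Qed.

(** Exponential Markov inequality with parameter [L / K]. The centred variable times [L / K] is at
    most [2 L <= 1/2] in absolute value, so its exponential moment is at most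
    [1 + 2 (2 L)^2 <= expR (8 L^2)]. The threshold contributes [- 11 L^2] per variable, which leaves
    [- 3 L^2]. *)
Lemma chernoff_iid d (T : measurableType d) (P : probability T R)
    (nu : probability R R) (X : nat -> {RV P >-> R}) (psi : R -> R) (n : nat)
    (K L : R) :
    iid_with_law X nu -> measurable_fun setT psi -> 0 < K ->
    (forall y, `|psi y| <= K) -> 0 <= L -> 4 * L <= 1 ->
  (P [set w | (11 * n%:R * K * L <=
      \sum_(i < n) (psi (X i w) - \int[nu]_y psi y))%R] <=
   (expR (- (3 * n%:R * L ^+ 2)))%:E)%E.
Proof.
move=> iid mpsi K0 psiK L0 L1; set e := \int[nu]_y psi y.
have K0' := ltW K0.
have ipsi : nu.-integrable setT (EFin \o psi).
  exact: bounded_integrable_probability psiK.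
have eK : `|e| <= K.
  apply: (le_trans (le_normr_Rintegral measurableT ipsi)).
  have -> : K = \int[nu]_y cst K y.
    by rewrite Rintegral_cst_probability.
  apply: le_Rintegral => //; first exact: integrable_norm.
  exact: finite_measure_integrable_cst.
pose f y := expR (L / K * (psi y - e - 11 * K * L)).
have mf : measurable_fun setT f.
  apply: measurableT_comp; first exact: measurable_expR.
  by apply: measurable_funM => //; apply: measurable_funB => //; apply: measurable_funB.
have f_int : (\int[nu]_y (f y)%:E <= (expR (- (3 * L ^+ 2)))%:E)%E.
  (* An integrable majorant affine in [psi]; its linear part is centred and integrates to 0. *)
  pose u y := expR (- (11 * L ^+ 2)) * (1 + 8 * L ^+ 2 + L / K * (psi y - e)).
  have fu y : f y <= u y.
    have -> : f y = expR (- (11 * L ^+ 2)) * expR (L / K * (psi y - e)).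
      by rewrite -expRD; congr expR; field; rewrite gt_eqF.
    rewrite ler_wpM2l ?expR_ge0//.
    have sL : `|L / K * (psi y - e)| <= 2 * L.
      rewrite normrM ger0_norm ?divr_ge0//.
      have -> : 2 * L = L / K * (2 * K) by field; rewrite gt_eqF.
      rewrite ler_wpM2l ?divr_ge0//.
      by have := ler_normB (psi y) e; have := psiK y; lra.
    have := sL; rewrite ler_norml => /andP[sL1 sL2].
    apply: le_trans (expR_le_quadratic _) _; first lra.
    have : `|L / K * (psi y - e)| ^+ 2 <= (2 * L) ^+ 2.
      by rewrite ler_sqr ?nnegrE ?normr_ge0// mulr_ge0.
    by rewrite real_normK ?num_real//; lra.
  have icst (c : R) : nu.-integrable setT (EFin \o cst c).
    exact: finite_measure_integrable_cst.
  pose v y := L / K * (psi y - e).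
  have ipsie : nu.-integrable setT (EFin \o (fun y => psi y - e)).
    exact: (integrableB measurableT ipsi (icst e)).
  have iv : nu.-integrable setT (EFin \o v).
    exact: (integrableZl measurableT (L / K) ipsie).
  have i1v : nu.-integrable setT (EFin \o (fun y => 1 + 8 * L ^+ 2 + v y)).
    exact: (integrableD measurableT (icst (1 + 8 * L ^+ 2)) iv).
  have iu : nu.-integrable setT (EFin \o u).
    exact: (integrableZl measurableT _ i1v).
  apply: (@le_trans _ _ (\int[nu]_y (u y)%:E)%E).
    apply: ge0_le_integral => //=.
    - by move=> y _; rewrite lee_fin expR_ge0.
    - exact/measurable_EFinP.
    - by case/integrableP: iu.
    - by move=> y _; rewrite lee_fin.
  have -> : (\int[nu]_y (u y)%:E = (\int[nu]_y u y)%:E)%E.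
    by rewrite /Rintegral fineK// integrable_fin_num.
  rewrite lee_fin /u RintegralZl// -/v (RintegralD measurableT (icst _) iv).
  rewrite RintegralZl// (RintegralB measurableT ipsi (icst e))
    !Rintegral_cst_probability subrr mulr0 addr0.
  have -> : - (3 * L ^+ 2) = - (11 * L ^+ 2) + 8 * L ^+ 2 by ring.
  by rewrite expRD ler_wpM2l ?expR_ge0// expR_ge1Dx.
have fE w : (\prod_(i < n) f (X i w) =
    expR (L / K * (\sum_(i < n) (psi (X i w) - e) - 11 * n%:R * K * L))).
  rewrite -expR_sum -mulr_sumr; congr (expR (_ * _)).
  by rewrite big_split/= sumr_const card_ord -mulr_natr; ring.
apply: (@le_trans _ _ (\int[P]_w (\prod_(i < n) f (X i w))%:E)%E).
  have mA := measurable_sum_ge X n e (11 * n%:R * K * L) mpsi.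
  rewrite -[X in P X]setIT -integral_indic//; apply: ge0_le_integral => //=.
  - by apply/measurable_EFinP; exact: measurable_indic.
  - apply/measurable_EFinP; apply: measurable_prod => i _.
    by apply: measurableT_comp.
  move=> w _; rewrite lee_fin indicE; case: (boolP (_ \in _)) => [|_]; last first.
    by rewrite prodr_ge0// => i _; exact: expR_ge0.
  rewrite inE/= => Aw; rewrite fE (le_trans _ (expR_ge1Dx _))//.
  by rewrite lerDl mulr_ge0 ?divr_ge0// subr_ge0.
rewrite (integral_prod_iid (f := fun=> f) n iid)//; last 2 first.
- by move=> _ y; exact: expR_ge0.
- by move=> _; rewrite (le_lt_trans f_int)// ltry.
have f_fin : (\int[nu]_y (f y)%:E)%E \is a fin_num.
  rewrite ge0_fin_numE ?(le_lt_trans f_int) ?ltry//.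
  by apply: integral_ge0 => y _; rewrite lee_fin expR_ge0.
rewrite (eq_bigr (fun=> (fine (\int[nu]_y (f y)%:E))%:E)); last by rewrite fineK.
rewrite prodEFin lee_fin prodr_const card_ord.
have -> : - (3 * n%:R * L ^+ 2) = n%:R * - (3 * L ^+ 2) by ring.
rewrite expRM_natl lerXn2r ?nnegrE ?expR_ge0//.
  by rewrite fine_ge0//; apply: integral_ge0 => y _; rewrite lee_fin expR_ge0.
by rewrite -lee_fin fineK.
Qed.

End concentration.

(** * Fluctuations of the empirical energy *)

Section fluctuation.
Variable R : realType.
Implicit Types (beta x y z : R) (nu : probability R R) (h : nat -> R).

Lemma chernoff_iid_norm d (T : measurableType d) (P : probability T R)
    (nu : probability R R) (X : nat -> {RV P >-> R}) (psi : R -> R) (n : nat)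
    (K L : R) :
    iid_with_law X nu -> measurable_fun setT psi -> 0 < K ->
    (forall y, `|psi y| <= K) -> 0 <= L -> 4 * L <= 1 ->
  let B := [set w | 11 * n%:R * K * L <=
      `|\sum_(i < n) (psi (X i w) - \int[nu]_y psi y)|] in
  measurable B /\ (P B <= (2 * expR (- (3 * n%:R * L ^+ 2)))%:E)%E.
Proof.
move=> iid mpsi K0 psiK L0 L1 B.
have ipsi : nu.-integrable setT (EFin \o psi).
  exact: bounded_integrable_probability psiK.
have mNpsi : measurable_fun setT (fun y => - psi y) by exact: measurable_funN.
have NpsiK y : `|- psi y| <= K by rewrite normrN.
have intN : \int[nu]_y (- psi y) = - \int[nu]_y psi y.
  by under eq_Rintegral do rewrite -mulN1r; rewrite RintegralZl// mulN1r.
have BE : B =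
    [set w | 11 * n%:R * K * L <= \sum_(i < n) (psi (X i w) - \int[nu]_y psi y)] `|`
    [set w | 11 * n%:R * K * L <=
      \sum_(i < n) (- psi (X i w) - \int[nu]_y (- psi y))].
  have sumN w : \sum_(i < n) (- psi (X i w) - \int[nu]_y (- psi y)) =
      - \sum_(i < n) (psi (X i w) - \int[nu]_y psi y).
    by rewrite -sumrN; apply: eq_bigr => i _; rewrite intN opprB opprK addrC.
  apply/seteqP; split => w; rewrite /B /= ler_normr sumN; first by move/orP.
  by move=> ?; apply/orP.
have m1 := measurable_sum_ge X n (\int[nu]_y psi y) (11 * n%:R * K * L) mpsi.
have m2 := measurable_sum_ge X n (\int[nu]_y (- psi y)) (11 * n%:R * K * L) mNpsi.
split; first by rewrite BE; exact: measurableU.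
have -> x : (2 * expR x)%:E = ((expR x)%:E + (expR x)%:E)%E :> \bar R.
  by rewrite -EFinD mulr_natl mulr2n.
rewrite BE (le_trans (measureU2 _ _ _))// leeD//.
  exact: (chernoff_iid n iid).
exact: (chernoff_iid n iid mNpsi).
Qed.

Lemma ln_le_sqrt (x : R) : 0 < x -> ln x <= 2 * Num.sqrt x.
Proof.
move=> x0; have -> : ln x = 2 * ln (Num.sqrt x).
  by rewrite -{1}(sqr_sqrtr (ltW x0)) lnXn ?sqrtr_gt0// mulr_natl.
by rewrite ler_wpM2l// ltW// ln_sublinear// sqrtr_gt0.
Qed.

Lemma inv_square_series_lty (c : R) : 0 <= c ->
  (\sum_(0 <= n <oo) (c / n.+1%:R ^+ 2)%:E < +oo)%E.
Proof.
move=> c0; apply: (@le_lt_trans _ _ (2 * c)%:E); last exact: ltry.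
apply: lime_le; first by apply: is_cvg_nneseries => n _ _; rewrite lee_fin divr_ge0.
apply: nearW => n; rewrite sumEFin lee_fin.
(* Telescoping majorant of the partial sums, which makes the induction close. *)
suff : \sum_(0 <= i < n) (c / i.+1%:R ^+ 2 : R) <= 2 * c - 2 * c / n.+1%:R.
  by move=> /le_trans; apply; rewrite gerBl divr_ge0// mulr_ge0.
elim: n => [|n IHn]; first by rewrite big_geq// divr1 subrr.
rewrite big_nat_recr//= (le_trans (lerD IHn (lexx _)))//.
rewrite -addrA lerD2l -subr_ge0.
have : 1 <= n.+1%:R :> R by rewrite ler1n.
rewrite -(natr1 n.+1).
move: (n.+1%:R) => x x1; have x0 : 0 < x by lra.
have x10 : 0 < x + 1 by lra.
have -> : - (2 * c / (x + 1)) - (- (2 * c / x) + c / x ^+ 2) =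
    c * (x - 1) / (x ^+ 2 * (x + 1)).
  by field; rewrite !gt_eqF.
by rewrite divr_ge0// mulr_ge0// ?subr_ge0 ?sqr_ge0// ltW.
Qed.

Definition energy_gap beta nu h n x : R :=
  empirical_energy beta h n x - free_energy beta nu x.

Definition ln_cosh_increment beta x y z : R :=
  ln (cosh (beta * (x + z))) - ln (cosh (beta * (y + z))).

Lemma ln_cosh_increment_le beta x y z : 0 <= beta ->
  `|ln_cosh_increment beta x y z| <= beta * `|x - y|.
Proof.
move=> beta0; apply: le_trans (ln_cosh_lipschitz _ _) _.
have -> : beta * (x + z) - beta * (y + z) = beta * (x - y) by ring.
by rewrite normrM ger0_norm.
Qed.

Lemma measurable_ln_cosh_increment beta x y :
  measurable_fun [set: R] (ln_cosh_increment beta x y).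
Proof. by apply: measurable_funB; exact: measurable_ln_cosh. Qed.

(** The quadratic term is common to both energies, so what remains is a centred empirical mean of
    bounded increments. *)
Lemma energy_gapB beta nu h n x y :
    (\int[nu]_x (x ^+ 2)%:E < +oo)%E -> (0 < n)%N ->
  energy_gap beta nu h n x - energy_gap beta nu h n y =
  - (n%:R^-1 * \sum_(i < n) (ln_cosh_increment beta x y (h i) -
       \int[nu]_z ln_cosh_increment beta x y z)).
Proof.
move=> nu2 n0; rewrite /energy_gap /free_energy /empirical_energy.
have nn0 : n%:R != 0 :> R by rewrite pnatr_eq0 -lt0n.
have sumE c : \sum_(i < n) (ln_cosh_increment beta x y (h i) - c) =
    \sum_(i < n) ln (cosh (beta * (x + h i))) -
    \sum_(i < n) ln (cosh (beta * (y + h i))) - n%:R * c.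
  by rewrite !big_split/= sumrN sumr_const card_ord mulNrn mulr_natl.
rewrite sumE RintegralB; [|by []|exact: integrable_ln_cosh|exact: integrable_ln_cosh].
set a := \sum_(i < n) _; set b := \sum_(i < n) _.
set c := \int[nu]_y _; set e := \int[nu]_y _.
rewrite [n%:R^-1 * (_ - n%:R * _)]mulrBr mulKf//.
move: a b c e n%:R^-1 => a b c e u; ring.
Qed.

(** One [beta] bounds the sampled increment, the other its mean. This controls the gap between grid
    points. *)
Lemma energy_gap_lipschitz beta nu h n x y :
    (\int[nu]_x (x ^+ 2)%:E < +oo)%E -> (0 < n)%N -> 0 <= beta ->
  `|energy_gap beta nu h n x - energy_gap beta nu h n y| <= 2 * beta * `|x - y|.
Proof.
move=> nu2 n0 beta0; rewrite energy_gapB// normrN normrM ger0_norm ?invr_ge0//.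
rewrite ler_pdivrMl ?ltr0n// (le_trans (ler_norm_sum _ _ _))//.
have -> : n%:R * (2 * beta * `|x - y|) = \sum_(i < n) 2 * (beta * `|x - y|).
  by rewrite sumr_const card_ord -mulr_natl; ring.
apply: ler_sum => i _; rewrite (le_trans (ler_normB _ _))// mulr_natl mulr2n.
rewrite lerD ?ln_cosh_increment_le//.
have imeas := measurable_ln_cosh_increment beta x y.
have iinc : nu.-integrable setT (EFin \o ln_cosh_increment beta x y).
  exact: (integrableB measurableT (integrable_ln_cosh beta x nu2)
    (integrable_ln_cosh beta y nu2)).
apply: (le_trans (le_normr_Rintegral measurableT iinc)).
have -> : beta * `|x - y| = \int[nu]_z cst (beta * `|x - y|) z.
  by rewrite Rintegral_cst_probability.
apply: le_Rintegral => //; first exact: integrable_norm.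
  exact: finite_measure_integrable_cst.
by move=> z _; exact: ln_cosh_increment_le.
Qed.

(** The value of [L] for which the Chernoff factor [expR (- (3 * n * L^2))] is [n^-3]: summable even
    after a union over order [n] grid points. *)
Definition fluctuation_scale (n : nat) : R := Num.sqrt (ln n%:R / n%:R).

Lemma fluctuation_scale_small :
  exists N, (0 < N)%N /\ forall n, (N <= n)%N -> 4 * fluctuation_scale n <= 1.
Proof.
(* [16 * ln n / n <= 32 / sqrt n], which is at most 1 from [n = 32^2] on. *)
exists (32 ^ 2)%N; split => [//|n n32].
have nR : 32 ^+ 2 <= n%:R :> R by rewrite -natrX ler_nat.
have n1 : 1 <= n%:R :> R by apply: le_trans nR; lra.
have n0 : 0 < n%:R :> R by lra.
have sq32 : 32 <= Num.sqrt n%:R :> R.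
  rewrite -(@ler_sqr R) ?nnegrE ?sqrtr_ge0// sqr_sqrtr//; exact: ltW.
rewrite -(@ler_sqr R) ?nnegrE ?mulr_ge0 ?sqrtr_ge0// exprMn sqr_sqrtr; last first.
  by rewrite divr_ge0 ?ln_ge0// ltW.
rewrite mulrA ler_pdivrMr// expr1n mul1r.
apply: (@le_trans _ _ (4 ^+ 2 * (2 * Num.sqrt n%:R))).
  by rewrite ler_wpM2l// ln_le_sqrt.
rewrite -[leRHS](sqr_sqrtr (ltW n0)) expr2 mulrA ler_wpM2r ?sqrtr_ge0//.
by apply: le_trans sq32; lra.
Qed.

Lemma energy_gap_increment_prob d (T : measurableType d) (P : probability T R)
    nu (X : nat -> {RV P >-> R}) beta m n t :
    (\int[nu]_x (x ^+ 2)%:E < +oo)%E -> iid_with_law X nu -> 0 < beta ->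
    t != 0 -> (0 < n)%N -> 4 * fluctuation_scale n <= 1 ->
  let gap w := energy_gap beta nu (fun i => X i w) n in
  let B := [set w | 11 * (beta * `|t|) * fluctuation_scale n <=
      `|gap w (m + t) - gap w m|] in
  measurable B /\ (P B <= (2 / n%:R ^+ 3)%:E)%E.
Proof.
move=> nu2 iid beta0 t0 n0 small gap B.
have nR0 : 0 < n%:R :> R by rewrite ltr0n.
have K0 : 0 < beta * `|t| by rewrite mulr_gt0// normr_gt0.
have psiK z : `|ln_cosh_increment beta (m + t) m z| <= beta * `|t|.
  by have := ln_cosh_increment_le (m + t) m z (ltW beta0); rewrite addrAC subrr add0r.
have [] := chernoff_iid_norm n iid (measurable_ln_cosh_increment beta (m + t) m)
  K0 psiK (sqrtr_ge0 _) small.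
set B' := [set w | _].
have -> : B' = B.
  have le_eq a b : (11 * n%:R * (beta * `|t|) * a <= b) =
      (11 * (beta * `|t|) * a <= n%:R^-1 * b).
    by rewrite ler_pdivlMl//; congr (_ <= _); ring.
  have normV : `|n%:R^-1| = n%:R^-1 :> R by rewrite ger0_norm ?invr_ge0.
  rewrite /B' /B /gap; apply/seteqP; split => w /=;
    by rewrite energy_gapB// normrN normrM normV le_eq.
rewrite sqr_sqrtr ?divr_ge0 ?ln_ge0 ?ler1n//.
have -> : 3 * n%:R * (ln n%:R / n%:R) = ln n%:R *+ 3 :> R.
  by field; rewrite gt_eqF.
by rewrite expRN -lnXn// lnK// posrE exprn_gt0.
Qed.

Lemma ae_energy_gap_increment d (T : measurableType d) (P : probability T R)
    nu (X : nat -> {RV P >-> R}) beta m :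
    (\int[nu]_x (x ^+ 2)%:E < +oo)%E -> iid_with_law X nu -> 0 < beta ->
  {ae P, forall w, exists N, forall n, (N <= n)%N -> forall t, `|t| <= 1 ->
    `|energy_gap beta nu (fun i => X i w) n (m + t) -
      energy_gap beta nu (fun i => X i w) n m| <=
      11 * beta * `|t| * fluctuation_scale n + 2 * beta / n%:R}.
Proof.
move=> nu2 iid beta0.
have [N0 [N0_gt0 small]] := fluctuation_scale_small.
pose B n t := [set w | 11 * (beta * `|t|) * fluctuation_scale n <=
  `|energy_gap beta nu (fun i => X i w) n (m + t) -
    energy_gap beta nu (fun i => X i w) n m|].
have BP n t : (N0 <= n)%N -> t != 0 ->
    measurable (B n t) /\ (P (B n t) <= (2 / n%:R ^+ 3)%:E)%E.
  by move=> nN0 t0; apply: energy_gap_increment_prob => //; [lia|exact: small].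
(* For [j < n] the points [(j + 1) / n] and their negatives form a grid of mesh [1 / n] on [[-1, 1]]
   without 0, where the increment vanishes. *)
pose A n j := B n (j.+1%:R / n%:R) `|` B n (- (j.+1%:R / n%:R)).
have AP n j : (N0 <= n)%N ->
    measurable (A n j) /\ (P (A n j) <= (4 / n%:R ^+ 3)%:E)%E.
  move=> nN0; have t0 : j.+1%:R / n%:R != 0 :> R.
    by rewrite mulf_neq0// ?invr_eq0 pnatr_eq0//; lia.
  have Nt0 : - (j.+1%:R / n%:R) != 0 :> R by rewrite oppr_eq0.
  have [m1 P1] := BP _ _ nN0 t0; have [m2 P2] := BP _ _ nN0 Nt0.
  split; first exact: (measurableU _ _ m1 m2).
  rewrite (le_trans (measureU2 P m1 m2))// (le_trans (leeD P1 P2))//.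
  by rewrite -EFinD lee_fin -mulrDl; lra.
(* The shift by [N0] keeps [n = k + N0] in the range of the Chernoff bound. A union of [n] events of
   probability at most [4 / n^3] has probability at most [4 / n^2]. *)
pose F k := \big[setU/set0]_(j < k + N0) A (k + N0)%N j.
have kN0 k : (N0 <= k + N0)%N by exact: leq_addl.
have mF k : measurable (F k).
  by apply: bigsetU_measurable => j _; have [] := AP _ j (kN0 k).
have PF k : (P (F k) <= (4 / k.+1%:R ^+ 2)%:E)%E.
  apply: (le_trans (Boole_inequality _ _)).
    by move=> j _; have [] := AP _ j (kN0 k).
  apply: (@le_trans _ _ (\sum_(j < k + N0) (4 / (k + N0)%:R ^+ 3)%:E)%E).
    by apply: lee_sum => j _; have [] := AP _ j (kN0 k).
  rewrite sumEFin lee_fin sumr_const card_ord -[leLHS]mulr_natl.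
  have n0 : 0 < (k + N0)%:R :> R by rewrite ltr0n; lia.
  have cancel_pow x : 0 < x -> x * (4 / x ^+ 3) = 4 / x ^+ 2.
    by move=> x0; field; rewrite gt_eqF.
  rewrite cancel_pow// ler_pM2l// lef_pV2 ?posrE ?exprn_gt0//.
  by rewrite ler_sqr ?nnegrE// ler_nat; lia.
exists (lim_sup_set F); split.
- apply: bigcapT_measurable => n; exact: bigcup_measurable.
- apply: lim_sup_set_cvg0 => //; apply: le_lt_trans (inv_square_series_lty (c := 4) _) => //.
  by apply: lee_nneseries => // k _; exact: PF.
move=> w /= good; apply: contrapT => notlim; apply: good.
have [N _ FN] : exists2 N, True & forall k, (N <= k)%N -> ~ F k w.
  apply: contrapT => noN; apply: notlim => N _.
  apply: contrapT => noF; apply: noN; exists N => // k Nk Fk; apply: noF.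
  by exists k.
exists (N + N0)%N => n Nn t t1.
set gap := energy_gap _ _ _ _.
have nN0 : (N0 <= n)%N by lia.
have n0 : (0 < n)%N by exact: leq_trans nN0.
have nR0 : 0 < n%:R :> R by rewrite ltr0n.
have notA j : (j < n)%N -> ~ A n j w.
  move=> jn Aj; have kn : ((n - N0) + N0 = n)%N by lia.
  apply: (FN (n - N0)%N); first lia.
  rewrite /F kn -bigcup_mkord; by exists j.
(* [t] is rounded towards 0 to the grid point [t']. As [|t'| <= |t|], the bound at [t'] is dominated
   by the one at [t]; the remaining distance, at most [1 / n], costs [2 * beta / n]. *)
pose j := Num.trunc (`|t| * n%:R).
have jt : j%:R <= `|t| * n%:R < j.+1%:R.
  by apply: truncn_itv; rewrite mulr_ge0.
have jn : (j <= n)%N.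
  rewrite -(@ler_nat R) (le_trans (andP jt).1)// ler_piMl//.
pose t' := Num.sg t * (j%:R / n%:R).
have j_le : j%:R / n%:R <= `|t| by rewrite ler_pdivrMr//; case/andP: jt.
have sg1 : `|Num.sg t| <= 1 by rewrite normr_sg; case: (_ == _); rewrite ?lexx.
have t'_le : `|t'| <= `|t|.
  rewrite normrM [X in _ * X]ger0_norm ?divr_ge0//.
  by apply: le_trans j_le; rewrite ler_piMl ?divr_ge0.
have tt' : `|t - t'| <= n%:R^-1.
  rewrite {1}(numEsg t) -mulrBr normrM.
  rewrite (le_trans (ler_piMl _ sg1))// ger0_norm ?subr_ge0//.
  rewrite lerBlDr -(ler_pM2r nR0) mulrDl mulVf ?mulfVK ?gt_eqF//.
  by rewrite addrC natr1 ltW//; case/andP: jt.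
have L0 : 0 <= fluctuation_scale n by exact: sqrtr_ge0.
have gapt' : `|gap (m + t') - gap m| <= 11 * beta * `|t'| * fluctuation_scale n.
  have [->|t'0] := eqVneq t' 0.
    by rewrite addr0 subrr normr0 mulr0 mul0r.
  have j0 : (0 < j)%N.
    by rewrite lt0n; apply: contra t'0 => /eqP j0; rewrite /t' j0 mul0r mulr0.
  have tn0 : t != 0 by apply: contra t'0 => /eqP tn0; rewrite /t' tn0 sgr0 mul0r.
  have /not_orP[B1 B2] : ~ A n j.-1 w by apply: notA; rewrite prednK.
  rewrite prednK// in B1 B2.
  have [tpos|tneg|t_0] := ltgtP t 0; last by rewrite t_0 eqxx in tn0.
    have t'E : t' = - (j%:R / n%:R) by rewrite /t' ltr0_sg// mulN1r.
    by move/negP: B2; rewrite -ltNge -t'E mulrA => /ltW.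
  have t'E : t' = j%:R / n%:R by rewrite /t' gtr0_sg// mul1r.
  by move/negP: B1; rewrite -ltNge -t'E mulrA => /ltW.
have := energy_gap_lipschitz (fun i => X i w) (m + t) (m + t') nu2 n0 (ltW beta0).
have -> : m + t - (m + t') = t - t' by ring.
rewrite -/gap => lip.
have -> : gap (m + t) - gap m = (gap (m + t) - gap (m + t')) + (gap (m + t') - gap m).
  by rewrite addrA subrK.
rewrite (le_trans (ler_normD _ _))// addrC lerD//.
  by rewrite (le_trans gapt')// ler_wpM2r// ler_wpM2l// mulr_ge0// ltW.
by rewrite (le_trans lip)// ler_wpM2l// mulr_ge0// ltW.
Qed.

End fluctuation.

(** * The free energy near a minimum *)

Section minimum.
Variable R : realType.
Implicit Types (beta m lambda t : R) (nu : probability R R).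

Lemma minimum_of_type_expansion (G : R -> R) m k lambda :
    minimum_of_type G m k lambda ->
  exists C delta, [/\ 0 < C, 0 < delta & forall t, `|t| <= delta ->
    `|G (m + t) - G m - lambda / ((2 * k)`!)%:R * t ^+ (2 * k)| <=
      C * `|t| ^+ (2 * k).+1].
Proof.
case=> _ _ _ expansion.
pose f x := G m + lambda / ((2 * k)`!)%:R * (x - m) ^+ (2 * k).
have : G = f +O_ (nbhs m) (fun x => (x - m) ^+ (2 * k).+1) by apply/funext.
move=> /eqaddOP [C [_ CO]].
have [C' [C'0 C'C]] : exists C', 0 < C' /\ C < C'.
  exists (`|C| + 1); split; first by rewrite ltr_wpDl.
  by rewrite ltr_pwDr// ler_norm.
have /nbhs_ballP[delta /= delta0 ball_delta] := CO _ C'C.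
exists C', (delta / 2); split=> // [|t t_delta]; first by rewrite divr_gt0.
have /ball_delta : ball m delta (m + t).
  rewrite -ball_normE/= opprD addrA subrr add0r normrN.
  by rewrite (le_lt_trans t_delta)// ltr_pdivrMr// ltr_pMr// ltr1n.
rewrite /f/= !fctE /= [m + t - m]addrAC subrr add0r normrX.
by rewrite opprD addrA.
Qed.

Lemma expR_sub_ge (a : R) : 0 <= a -> a <= expR a - expR (- a).
Proof.
move=> a0; have := expR_ge1Dx a; have : expR (- a) <= 1 by rewrite -expR0 ler_expR oppr_le0.
lra.
Qed.

(** A quantitative strict convexity: [cosh (z + a) cosh (z - a) = cosh^2 z + sinh^2 a] with
    [sinh^2 a >= a^2 / 4], then [ln (1 + p) >= p / (1 + p)] for [p = a^2 / (4 cosh^2 z)]. *)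
Lemma ln_cosh_second_difference_ge (z a : R) :
  a ^+ 2 / (4 * cosh z ^+ 2 + a ^+ 2) <=
  ln (cosh (z + a)) + ln (cosh (z - a)) - 2 * ln (cosh z).
Proof.
have c0 := cosh_gt0 z; have c20 : 0 < cosh z ^+ 2 by rewrite exprn_gt0.
have den0 : 0 < 4 * cosh z ^+ 2 + a ^+ 2 by rewrite ltr_pwDl ?sqr_ge0// mulr_gt0.
have prod_ge : cosh z ^+ 2 + a ^+ 2 / 4 <= cosh (z + a) * cosh (z - a).
  have -> : cosh (z + a) * cosh (z - a) =
      cosh z ^+ 2 + (expR a - expR (- a)) ^+ 2 / 4.
    rewrite /cosh opprD opprB !expRD !expRN.
    have := expR_gt0 z; have := expR_gt0 a.
    move: (expR z) (expR a) => p q q0 p0; field.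
    by rewrite !gt_eqF.
  rewrite lerD2l ler_pM2r ?invr_gt0//.
  have -> : (expR a - expR (- a)) ^+ 2 = (expR `|a| - expR (- `|a|)) ^+ 2.
    have [a0|a0] := ger0P a => //; rewrite opprK; ring.
  rewrite -(real_normK (num_real a)) ler_sqr ?nnegrE//; exact: expR_sub_ge.
have -> : 2 * ln (cosh z) = ln (cosh z ^+ 2) by rewrite lnXn// mulr_natl.
have p0 := cosh_gt0 (z + a); have m0 := cosh_gt0 (z - a).
have D4 : 0 < 4 * cosh z ^+ 2 by rewrite mulr_gt0.
have ratio0 : 0 < (4 * cosh z ^+ 2 + a ^+ 2) / (4 * cosh z ^+ 2).
  by rewrite divr_gt0.
have pm0 : 0 < cosh (z + a) * cosh (z - a) by rewrite mulr_gt0.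
rewrite -lnM ?posrE// -ln_div ?posrE//.
apply: (@le_trans _ _ (ln ((4 * cosh z ^+ 2 + a ^+ 2) / (4 * cosh z ^+ 2)))); last first.
  rewrite ler_ln ?posrE//; last by rewrite divr_gt0.
  rewrite ler_pdivlMr// (le_trans _ prod_ge)// le_eqVlt; apply/orP; left; apply/eqP.
  by field; rewrite gt_eqF.
have : ln (1 + - (a ^+ 2 / (4 * cosh z ^+ 2 + a ^+ 2))) <=
    - (a ^+ 2 / (4 * cosh z ^+ 2 + a ^+ 2)).
  by apply: le_ln1Dx; rewrite ltrN2 ltr_pdivrMr// mul1r ltrDr.
have -> : 1 + - (a ^+ 2 / (4 * cosh z ^+ 2 + a ^+ 2)) =
    ((4 * cosh z ^+ 2 + a ^+ 2) / (4 * cosh z ^+ 2))^-1.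
  by rewrite invf_div; field; rewrite gt_eqF.
by rewrite lnV ?posrE// lerN2.
Qed.

Lemma integral_pos nu (f : R -> R) : measurable_fun setT f ->
  (forall y, 0 < f y) -> nu.-integrable setT (EFin \o f) -> 0 < \int[nu]_y f y.
Proof.
move=> mf f0 intf.
rewrite lt_neqAle Rintegral_ge0 ?andbT; last by move=> y _; exact: ltW.
apply/negP => /eqP int0.
have : ae_eq nu setT (EFin \o f) (cst 0%E).
  apply/ae_eq_integral_abs => //; first exact/measurable_EFinP.
  under eq_integral do rewrite /= gtr0_norm//.
  by rewrite -[LHS]fineK ?integrable_fin_num// -/(Rintegral _ _ _) -int0.
case=> N [mN N0 Nsub].
have : nu setT = 0%E.
  apply/eqP; rewrite eq_le measure_ge0 andbT -N0 le_measure ?inE//.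
  move=> y _; apply: Nsub => /= /(_ Logic.I) /eqP; rewrite eqe gt_eqF//.
by rewrite probability_setT => /eqP; rewrite onee_eq0.
Qed.

(** This makes [sigma^2] positive. The second difference of [G] at [m] is [lambda t^2] up to
    [2 C t^3] by the expansion, and at most [(beta - c) t^2] with [c > 0] by strict convexity of
    [ln cosh]. Working with differences avoids differentiating under the integral. *)
Lemma strength_lt_beta beta nu m lambda : 0 < beta ->
    (\int[nu]_x (x ^+ 2)%:E < +oo)%E ->
    minimum_of_type (free_energy beta nu) m 1 lambda ->
  lambda < beta.
Proof.
move=> beta0 nu2 min1; have [_ _ lambda0 _] := min1.
have [C [delta [C0 delta0 expansion]]] := minimum_of_type_expansion min1.
pose l x y := ln (cosh (beta * (x + y))).
have il x : nu.-integrable setT (EFin \o l x) by exact: integrable_ln_cosh.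
(* The convexity bound at [a = beta * t] is at least [t^2 * f y] for [|t| <= 1], with [f]
   independent of [t]. *)
pose f y := beta ^+ 2 / (4 * cosh (beta * (m + y)) ^+ 2 + beta ^+ 2).
have den0 y : 0 < 4 * cosh (beta * (m + y)) ^+ 2 + beta ^+ 2.
  by rewrite ltr_pwDr ?exprn_gt0// mulr_ge0// sqr_ge0.
have f0 y : 0 < f y by rewrite divr_gt0 ?exprn_gt0.
have mf : measurable_fun setT f.
  (* The positive quotient is written through [expR] and [ln] to become a composition of measurable
     functions. *)
  rewrite (_ : f = fun y => beta ^+ 2 *
      expR (- ln (4 * expR (ln (cosh (beta * (m + y)))) ^+ 2 + beta ^+ 2))).
    apply: measurable_funM => //; apply: measurableT_comp; first exact: measurable_expR.
    apply: measurableT_comp => //; apply: measurableT_comp; first exact: measurable_ln.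
    apply: measurable_funD => //; apply: measurable_funM => //.
    apply: measurable_funX; apply: measurableT_comp; first exact: measurable_expR.
    exact: measurable_ln_cosh.
  apply/funext => y; rewrite /f [expR (ln (cosh _))]lnK ?posrE ?cosh_gt0//.
  by rewrite expRN lnK ?posrE.
have intf : nu.-integrable setT (EFin \o f).
  apply: (@bounded_integrable_probability _ nu f 1) => // y; rewrite gtr0_norm//.
  by rewrite ler_pdivrMr// mul1r lerDr mulr_ge0// sqr_ge0.
have c0 := integral_pos mf f0 intf; set c := \int[nu]_y f y in c0.
have second_difference t : `|t| <= 1 ->
    free_energy beta nu (m + t) + free_energy beta nu (m - t) -
    2 * free_energy beta nu m <= (beta - c) * t ^+ 2.
  move=> t1; pose psi y := l (m + t) y + l (m - t) y - 2 * l m y.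
  have i2 := integrableD measurableT (il (m + t)) (il (m - t)).
  have i3 := integrableZl measurableT 2 (il m).
  have ipsi : nu.-integrable setT (EFin \o psi) by exact: (integrableB measurableT i2 i3).
  have : \int[nu]_y (t ^+ 2 * f y) <= \int[nu]_y psi y.
    apply: le_Rintegral => //; first exact: (integrableZl measurableT (t ^+ 2) intf).
    move=> y _; rewrite /psi /l.
    have -> : beta * (m + t + y) = beta * (m + y) + beta * t by ring.
    have -> : beta * (m - t + y) = beta * (m + y) - beta * t by ring.
    apply: le_trans (ln_cosh_second_difference_ge _ _).
    have D0 : 0 < 4 * cosh (beta * (m + y)) ^+ 2.
      by rewrite mulr_gt0// exprn_gt0// cosh_gt0.
    rewrite /f mulrA -exprMn [t * beta]mulrC ler_wpM2l ?sqr_ge0//.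
    rewrite lef_pV2 ?posrE//; last by rewrite ltr_pwDl// sqr_ge0.
    by rewrite lerD2l exprMn ler_piMr ?sqr_ge0// -(real_normK (num_real t)) expr_le1.
  have -> : \int[nu]_y psi y =
      \int[nu]_y l (m + t) y + \int[nu]_y l (m - t) y - 2 * \int[nu]_y l m y.
    by rewrite (RintegralB measurableT i2 i3) RintegralD// RintegralZl.
  rewrite RintegralZl// -/c /free_energy -/(l (m + t)) => int_ge.
  have -> : (beta - c) * t ^+ 2 = beta * t ^+ 2 - t ^+ 2 * c by ring.
  move: int_ge; rewrite /l.
  move: (\int[nu]_y _) (\int[nu]_y _) (\int[nu]_y _) => A B D.
  move: (c) (t) => e u; clear; lra.
rewrite ltNge; apply/negP => beta_le.
(* The cubic errors then total at most [c t^2 / 2], less than the convexity gain [c t^2]. *)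
have [t [t0 t1 td tC]] :
    exists t, [/\ 0 < t, t <= 1, t <= delta & 4 * (C * t) <= c].
  exists (Num.min (Num.min delta 1) (c / (4 * C))); split.
  - by rewrite !lt_min delta0 ltr01 divr_gt0// mulr_gt0.
  - by rewrite !ge_min lexx orbT.
  - by rewrite !ge_min lexx.
  by rewrite mulrA -ler_pdivlMl ?mulr_gt0// mulrC ge_min lexx orbT.
have Nt : `|- t| <= delta by rewrite normrN gtr0_norm.
have Pt : `|t| <= delta by rewrite gtr0_norm.
have t1' : `|t| <= 1 by rewrite gtr0_norm.
have := expansion _ Pt; have := expansion _ Nt; have := second_difference t t1'.
rewrite normrN (gtr0_norm t0) muln1 sqrrN.
move: (free_energy beta nu (m + t)) (free_energy beta nu (m - t)) (free_energy beta nu m).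
have -> : (2`!)%:R = 2 :> R by [].
rewrite exprS => Gp Gm G H.
rewrite !ler_norml => /andP[H1 _] /andP[H2 _].
have gap0 : 0 < t ^+ 2 * (c - 2 * (C * t)).
  by rewrite mulr_gt0 ?exprn_gt0// subr_gt0; clear -tC c0; lra.
have slope0 : 0 <= t ^+ 2 * (lambda - beta) by rewrite mulr_ge0 ?subr_ge0 ?sqr_ge0.
clear -H H1 H2 gap0 slope0; move: (c) H gap0 => e *; lra.
Qed.

End minimum.

(** * Space and speed scales *)

Section scales.
Variable R : realType.

Lemma cvg_powRN (p : R) : 0 < p -> (n%:R : R) `^ (- p) @[n --> \oo] --> (0 : R).
Proof.
move=> p0; apply/cvgr0Pnorm_le => e e0.
near=> n.
have n0 : 0 < n%:R :> R by near: n; exact: nbhs_infty_gtr.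
have en : e `^ (- p^-1) <= n%:R by near: n; exact: nbhs_infty_ger.
rewrite ger0_norm ?powR_ge0// powRN -[leRHS]invrK lef_pV2 ?posrE ?invr_gt0 ?powR_gt0//.
have -> : e^-1 = (e `^ (- p^-1)) `^ p.
  by rewrite -powRrM mulNr mulVf ?gt_eqF// powR_inv1// ltW.
by rewrite ge0_ler_powR ?nnegrE ?powR_ge0 ?ler0n// ltW.
Unshelve. all: by end_near. Qed.

Lemma ln_le_powR (p x : R) : 0 < p -> 0 < x -> ln x <= x `^ p / p.
Proof.
move=> p0 x0; rewrite ler_pdivlMr// mulrC -ln_powR ltW// ln_sublinear//.
by rewrite powR_gt0.
Qed.

Implicit Types (k n : nat) (alpha : R).

Definition space_scale alpha n : R := n%:R `^ (alpha - 1).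
Definition speed k alpha n : R := n%:R `^ (1 - 2 * k%:R * (1 - alpha)).

Definition moderate_range k alpha : Prop :=
  (1 <= k)%N /\ 1 - (2 * (2 * k%:R - 1))^-1 < alpha < 1.

(** The third bound makes the field fluctuations negligible. The fourth makes the speed diverge, and
    follows from the third because [2 k <= 2 (2 k - 1)]. *)
Lemma moderate_range_bounds k alpha : moderate_range k alpha ->
  [/\ 1 <= k%:R :> R, 0 < 1 - alpha, (2 * k%:R - 1) * (1 - alpha) < 2^-1 &
      0 < 1 - 2 * k%:R * (1 - alpha)].
Proof.
case=> k1 /andP[a1 a2]; have kR1 : 1 <= k%:R :> R by rewrite ler1n.
have a0 : 0 < 1 - alpha by lra.
have kalpha : (2 * k%:R - 1) * (1 - alpha) < 2^-1.
  have d0 : 0 < 2 * (2 * k%:R - 1) :> R by lra.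
  have : (1 - alpha) * (2 * (2 * k%:R - 1)) < 1.
    by rewrite -ltr_pdivlMr// div1r; lra.
  lra.
split=> //; have : 0 <= (2 * k%:R - 2) * (1 - alpha).
  by apply: mulr_ge0; [lra|exact: ltW].
by lra.
Qed.

Lemma space_scale_gt0 alpha n : (0 < n)%N -> 0 < space_scale alpha n.
Proof. by move=> n0; rewrite powR_gt0 ?ltr0n. Qed.

Lemma speed_gt0 k alpha n : (0 < n)%N -> 0 < speed k alpha n.
Proof. by move=> n0; rewrite powR_gt0 ?ltr0n. Qed.

Lemma speedE k alpha n : (0 < n)%N -> speed k alpha n = n%:R * space_scale alpha n ^+ (2 * k).
Proof.
move=> n0; rewrite /speed /space_scale -powR_mulrn ?powR_ge0// -powRrM.
rewrite -{2}(powRr1 (ler0n _ n)) -powRD; last first.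
  by apply/implyP; rewrite pnatr_eq0 -lt0n n0.
congr (_ `^ _); rewrite natrM; ring.
Qed.

Lemma space_scale_cvg k alpha : moderate_range k alpha -> space_scale alpha n @[n --> \oo] --> 0.
Proof.
case/moderate_range_bounds=> _ a0 _ _.
rewrite /space_scale (_ : alpha - 1 = - (1 - alpha)); last by ring.
exact: cvg_powRN.
Qed.

Lemma inv_speed_cvg k alpha : moderate_range k alpha ->
  (speed k alpha n)^-1 @[n --> \oo] --> 0.
Proof.
case/moderate_range_bounds=> _ _ _ s0.
rewrite /speed; under eq_cvg do rewrite -powRN; exact: cvg_powRN.
Qed.

(** The prefactors [n + 1] of the upper bound and [1/2] of the lower bound are thus invisible on the
    exponential scale. *)
Lemma ln_div_speed_cvg k alpha : moderate_range k alpha ->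
  ln (2 * n.+1%:R) / speed k alpha n @[n --> \oo] --> 0.
Proof.
case/moderate_range_bounds=> _ _ _ s0.
have [s [s_gt0 vE]] : exists s, 0 < s /\ forall n, speed k alpha n = n%:R `^ s.
  by exists (1 - 2 * k%:R * (1 - alpha)).
have s20 : 0 < s / 2 by rewrite divr_gt0.
have : 4 `^ (s / 2) / (s / 2) * n%:R `^ (- (s / 2)) @[n --> \oo] --> (0 : R).
  by rewrite -[X in _ --> X](mulr0 (4 `^ (s / 2) / (s / 2))); apply: cvgMr; exact: cvg_powRN.
apply: (@squeeze_cvgr _ _ _ _ (cst 0)); last exact: cvg_cst.
near=> n.
have n1 : (1 <= n)%N by near: n; exact: nbhs_infty_ge.
have n0 : 0 < n%:R :> R by rewrite ltr0n.
rewrite divr_ge0 ?powR_ge0 ?ln_ge0//=; last first.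
  by rewrite -natrM ler1n; lia.
rewrite ler_pdivrMr ?speed_gt0// vE.
rewrite -[leRHS]mulrA -powRD; last by rewrite (gt_eqF n0) implybT.
have -> : - (s / 2) + s = s / 2 by rewrite {2}(splitr s) addKr.
have n4 : 2 * n.+1%:R <= 4 * n%:R :> R by rewrite -!natrM ler_nat; lia.
apply: (@le_trans _ _ (ln (4 * n%:R))).
  by rewrite ler_ln ?posrE ?mulr_gt0 ?ltr0Sn.
apply: (le_trans (ln_le_powR s20 _)); first by rewrite mulr_gt0.
by rewrite powRM// mulrAC.
Unshelve. all: by end_near. Qed.

Definition fluctuation_rate k alpha n : R :=
  n%:R * space_scale alpha n * fluctuation_scale R n / speed k alpha n.

(** The rate equals [n^(-q) sqrt (ln n)] with [q = 1/2 - (2 k - 1) (1 - alpha)], and [q > 0] is the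
    lower bound on [alpha]. The logarithm is absorbed by [ln n <= n^q / q], leaving [n^(- q / 2)] up
    to a constant. *)
Lemma fluctuation_rate_cvg k alpha : moderate_range k alpha ->
  fluctuation_rate k alpha n @[n --> \oo] --> 0.
Proof.
case/moderate_range_bounds=> _ _ kalpha _.
have [q [q0 qE]] : exists q, 0 < q /\ q = 2^-1 - (2 * k%:R - 1) * (1 - alpha).
  by eexists; split; [|reflexivity]; lra.
have q20 : 0 < q / 2 by rewrite divr_gt0.
have : (q^-1) `^ 2^-1 * n%:R `^ (- (q / 2)) @[n --> \oo] --> (0 : R).
  by rewrite -[X in _ --> X](mulr0 ((q^-1) `^ 2^-1)); apply: cvgMr; exact: cvg_powRN.
apply: (@squeeze_cvgr _ _ _ _ (cst 0)); last exact: cvg_cst.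
near=> n.
have n1 : (1 <= n)%N by near: n; exact: nbhs_infty_ge.
have n0 : 0 < n%:R :> R by rewrite ltr0n.
rewrite /fluctuation_rate divr_ge0 ?powR_ge0 ?mulr_ge0 ?powR_ge0 ?sqrtr_ge0//=.
have L_le : fluctuation_scale R n <= (q^-1) `^ 2^-1 * n%:R `^ ((q - 1) / 2).
  rewrite /fluctuation_scale -powR12_sqrt; last by rewrite divr_ge0 ?ln_ge0// ler1n.
  rewrite powRrM -powRM ?invr_ge0 ?powR_ge0 ?(ltW q0)//.
  have lnn : 0 <= ln n%:R :> R by rewrite ln_ge0// ler1n.
  apply: ge0_ler_powR; rewrite ?nnegrE ?invr_ge0 ?divr_ge0//.
    by rewrite mulr_ge0 ?powR_ge0// invr_ge0 ltW.
  rewrite ler_pdivrMr//; apply: (le_trans (ln_le_powR q0 n0)).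
  rewrite -mulrA -[X in n%:R `^ (q - 1) * X](powRr1 (ler0n R n)) -powRD; last first.
    by rewrite (gt_eqF n0) implybT.
  by rewrite subrK mulrC.
rewrite ler_pdivrMr ?speed_gt0//.
apply: (@le_trans _ _ (n%:R * space_scale alpha n * ((q^-1) `^ 2^-1 * n%:R `^ ((q - 1) / 2)))).
  by rewrite ler_wpM2l// mulr_ge0 ?powR_ge0.
rewrite mulrCA -[leRHS]mulrA ler_wpM2l ?powR_ge0// le_eqVlt; apply/orP; left; apply/eqP.
have nE : n%:R = n%:R `^ 1 :> R by rewrite powRr1.
rewrite /space_scale /speed {1}nE.
rewrite -!powRD; try by rewrite (gt_eqF n0) implybT.
by congr (_ `^ _); rewrite qE; field.
Unshelve. all: by end_near. Qed.

(* [n r^2 = n^(2 alpha - 1)], the scale of the Gaussian fluctuations. *)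
Definition gaussian_speed alpha n : R := n%:R * space_scale alpha n ^+ 2.

Lemma gaussian_speed_gt0 alpha n : (0 < n)%N -> 0 < gaussian_speed alpha n.
Proof. by move=> n0; rewrite mulr_gt0 ?ltr0n// exprn_gt0// space_scale_gt0. Qed.

Lemma inv_gaussian_speed_cvg k alpha : moderate_range k alpha ->
  (gaussian_speed alpha n)^-1 @[n --> \oo] --> 0.
Proof.
case/moderate_range_bounds=> k1 a0 kalpha _.
have e0 : 0 < 2 * alpha - 1.
  have : 0 <= (2 * k%:R - 2) * (1 - alpha) by apply: mulr_ge0; [lra|exact: ltW].
  by lra.
apply: cvg_trans (cvg_powRN e0); apply: near_eq_cvg; near=> n.
have n1 : (1 <= n)%N by near: n; exact: nbhs_infty_ge.
rewrite powRN; congr (_^-1); rewrite /gaussian_speed /space_scale.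
rewrite -powR_mulrn ?powR_ge0// -powRrM.
rewrite -{2}(powRr1 (ler0n _ n)) -powRD; last first.
  by apply/implyP; rewrite pnatr_eq0 -lt0n n1.
congr (_ `^ _); ring.
Unshelve. all: by end_near. Qed.

(** The ratio is the space scale to the power [2 k - 2 > 0]; one factor tends to 0, the others are
    at most 1. *)
Lemma speed_div_gaussian_speed_cvg k alpha : moderate_range k alpha -> (1 < k)%N ->
  speed k alpha n / gaussian_speed alpha n @[n --> \oo] --> 0.
Proof.
move=> range k2.
have r_cvg : space_scale alpha n @[n --> \oo] --> (0 : R) by exact: (space_scale_cvg range).
move: (r_cvg).
apply: (@squeeze_cvgr _ _ _ _ (cst 0)); last exact: cvg_cst.
near=> n.
have n1 : (1 <= n)%N by near: n; exact: nbhs_infty_ge.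
have n0 : 0 < n%:R :> R by rewrite ltr0n.
have r0 := space_scale_gt0 alpha n1.
have r1 : space_scale alpha n <= 1.
  by near: n; have /cvgr0Pnorm_le/(_ 1 ltr01) := r_cvg; apply: filterS => n;
     apply: le_trans; exact: ler_norm.
rewrite divr_ge0 ?mulr_ge0 ?powR_ge0 ?sqr_ge0//= /gaussian_speed speedE//.
have -> : (2 * k = (2 * k - 3).+1 + 2)%N by lia.
rewrite exprD mulrCA mulfK; last by rewrite mulf_neq0 ?expf_neq0// gt_eqF.
by rewrite exprS ler_piMr ?(ltW r0)// exprn_ile1 ?(ltW r0).
Unshelve. all: by end_near. Qed.
End scales.

(** * The empirical energy on the moderate scale *)

Section rescaled_energy.
Variable R : realType.
Implicit Types (k n : nat) (alpha : R).

(** All that is retained of the realization of the field: the Taylor error of [G] plus the almost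
    sure fluctuation of the empirical energy. *)
Definition empirical_expansion (gn : nat -> R -> R) k (Lambda C K delta : R) N :=
  forall n, (N <= n)%N -> forall t, `|t| <= delta ->
    `|gn n t - Lambda * t ^+ (2 * k)| <=
      C * `|t| ^+ (2 * k).+1 + K * (`|t| * fluctuation_scale R n + n%:R^-1).

Variables (gn : nat -> R -> R) (k : nat) (Lambda C K delta : R) (N : nat).
Variable alpha : R.

Local Notation r := (space_scale alpha).
Local Notation v := (speed k alpha).
Local Notation e := (fluctuation_rate k alpha).

(** As [v n = n * r n ^ (2 k)], substituting [t = tau * r n] and multiplying by [n] turns each term
    of the expansion into [v n] times a rescaled term. *)
Lemma rescaled_energy_bound n (tau : R) :
    empirical_expansion gn k Lambda C K delta N ->
    (N <= n)%N -> (0 < n)%N -> `|tau * r n| <= delta ->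
  `|n%:R * gn n (tau * r n) - v n * (Lambda * tau ^+ (2 * k))| <=
    v n * (C * `|tau * r n| * tau ^+ (2 * k) + K * (`|tau| * e n + (v n)^-1)).
Proof.
move=> expansion Nn n0 tau_delta; have nR0 : 0 < n%:R :> R by rewrite ltr0n.
have r0 := space_scale_gt0 alpha n0; have v0 := speed_gt0 k alpha n0.
have vE : v n = n%:R * r n ^+ (2 * k) by apply: speedE.
have -> : n%:R * gn n (tau * r n) - v n * (Lambda * tau ^+ (2 * k)) =
    n%:R * (gn n (tau * r n) - Lambda * (tau * r n) ^+ (2 * k)).
  by rewrite vE exprMn; ring.
have -> : v n * (C * `|tau * r n| * tau ^+ (2 * k) + K * (`|tau| * e n + (v n)^-1)) =
    n%:R * (C * `|tau * r n| ^+ (2 * k).+1 +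
    K * (`|tau * r n| * fluctuation_scale R n + n%:R^-1)).
  rewrite exprS normrM (gtr0_norm r0) exprMn normrX_even mulrDr [RHS]mulrDr.
  congr (_ + _); first by rewrite vE; ring.
  rewrite mulrCA [RHS]mulrCA; congr (_ * _).
  rewrite !mulrDr mulfV ?gt_eqF// mulfV ?gt_eqF//; congr (_ + _).
  rewrite /fluctuation_rate; field; by rewrite gt_eqF.
rewrite normrM gtr0_norm// ler_wpM2l ?(ltW nR0)//; exact: expansion.
Qed.

Lemma rescaled_energy_cvg (T eps : R) :
    0 <= C -> 0 <= K -> 0 < delta -> moderate_range k alpha ->
    empirical_expansion gn k Lambda C K delta N ->
    0 <= T -> 0 < eps ->
  \forall n \near \oo, forall tau, `|tau| <= T ->
    `|n%:R * gn n (tau * r n) - v n * (Lambda * tau ^+ (2 * k))| <= v n * eps.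
Proof.
move=> C0 K0 delta0 range expansion T0 eps0.
have bound_cvg : C * T ^+ (2 * k).+1 * r n + K * (T * e n + (v n)^-1)
    @[n --> \oo] --> (0 : R).
  rewrite -[X in _ --> X](_ : C * T ^+ (2 * k).+1 * 0 + K * (T * 0 + 0) = 0); last by ring.
  apply: cvgD; first by apply: cvgMr; exact: space_scale_cvg range.
  apply: cvgMr; apply: cvgD; last exact: inv_speed_cvg range.
  by apply: cvgMr; exact: fluctuation_rate_cvg range.
have Tr_cvg : T * r n @[n --> \oo] --> (0 : R).
  by rewrite -[X in _ --> X](mulr0 T); apply: cvgMr; exact: space_scale_cvg range.
near=> n => tau tauT.
have n0 : (0 < n)%N by near: n; exact: nbhs_infty_gt.
have Nn : (N <= n)%N by near: n; exact: nbhs_infty_ge.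
have r0 := space_scale_gt0 alpha n0; have v0 := speed_gt0 k alpha n0.
have taur : `|tau * r n| <= T * r n.
  by rewrite normrM (gtr0_norm r0) ler_wpM2r ?(ltW r0).
have Tr : T * r n <= delta.
  apply: le_trans (ler_norm _) _; near: n.
  by have /cvgr0Pnorm_le/(_ delta delta0) := Tr_cvg.
apply: le_trans (rescaled_energy_bound expansion Nn n0 (le_trans taur Tr)) _.
rewrite ler_wpM2l ?(ltW v0)//.
apply: (@le_trans _ _ (C * T ^+ (2 * k).+1 * r n + K * (T * e n + (v n)^-1))).
  rewrite lerD//.
    rewrite exprS; have -> : C * (T * T ^+ (2 * k)) * r n =
      C * (T * r n) * T ^+ (2 * k) by ring.
    apply: ler_pM => //.
    - by rewrite mulr_ge0.
    - by rewrite exprM exprn_ge0 ?sqr_ge0.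
    - by rewrite ler_wpM2l.
    rewrite !exprM lerXn2r ?nnegrE ?sqr_ge0// -(real_normK (num_real tau)).
    by rewrite lerXn2r ?nnegrE.
  rewrite ler_wpM2l// lerD2r ler_wpM2r// /fluctuation_rate.
  by rewrite divr_ge0 ?(ltW v0)// mulr_ge0 ?sqrtr_ge0// mulr_ge0 ?(ltW r0).
apply: le_trans (ler_norm _) _; near: n.
by have /cvgr0Pnorm_le/(_ eps eps0) := bound_cvg.
Unshelve. all: by end_near. Qed.

(** Here [tau] may grow like [A / r n], so the errors are compared with [tau^(2 k)] instead of being
    small: the Taylor term takes half of [Lambda] by the choice of [A], the fluctuations a quarter
    since [|tau| <= tau^(2 k)]. The [+ 1] in [C + 1] keeps the denominator positive. *)
Lemma rescaled_energy_tail (A : R) :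
    0 <= C -> 0 <= K -> A <= delta -> moderate_range k alpha ->
    empirical_expansion gn k Lambda C K delta N ->
    0 < Lambda -> A <= Lambda / (2 * (C + 1)) ->
  \forall n \near \oo, forall tau, 1 <= `|tau| -> `|tau * r n| <= A ->
    v n * (Lambda / 4 * tau ^+ (2 * k)) <= n%:R * gn n (tau * r n).
Proof.
move=> C0 K0 A_delta range expansion Lambda0 A_le.
have Lambda4 : 0 < Lambda / 4 by rewrite divr_gt0.
have bound_cvg : K * (e n + (v n)^-1) @[n --> \oo] --> (0 : R).
  rewrite -[X in _ --> X](_ : K * (0 + 0) = 0); last by ring.
  apply: cvgMr; apply: cvgD; last exact: inv_speed_cvg range.
  exact: fluctuation_rate_cvg range.
have bound_small := (cvgr0Pnorm_le _).1 bound_cvg _ Lambda4.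
near=> n => tau tau1 tauA.
have n0 : (0 < n)%N by near: n; exact: nbhs_infty_gt.
have Nn : (N <= n)%N by near: n; exact: nbhs_infty_ge.
have r0 := space_scale_gt0 alpha n0; have v0 := speed_gt0 k alpha n0.
have tau_delta : `|tau * r n| <= delta by exact: le_trans A_delta.
have := rescaled_energy_bound expansion Nn n0 tau_delta.
have [k1 _] := range.
have tau2k : `|tau| <= tau ^+ (2 * k) by exact: ler_norm_exprn_even.
have small : K * (e n + (v n)^-1) <= Lambda / 4.
  by apply: le_trans (ler_norm _) _; near: n; exact: bound_small.
have CA : C * `|tau * r n| <= Lambda / 2.
  have C10 : 0 < C + 1 by rewrite ltr_wpDl.
  apply: (@le_trans _ _ ((C + 1) * (Lambda / (2 * (C + 1))))).
    by rewrite ler_pM// ?lerDl// (le_trans tauA).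
  by rewrite le_eqVlt; apply/orP; left; apply/eqP; field; rewrite gt_eqF.
have e0 : 0 <= e n.
  rewrite /fluctuation_rate.
  by rewrite divr_ge0 ?(ltW v0)// mulr_ge0 ?sqrtr_ge0// mulr_ge0 ?(ltW r0).
have v0' : 0 <= (v n)^-1 by rewrite invr_ge0 ltW.
have tau2k1 : 1 <= tau ^+ (2 * k) by exact: le_trans tau2k.
have tau2k0 : 0 <= tau ^+ (2 * k) by exact: le_trans tau2k1.
have error_le : C * `|tau * r n| * tau ^+ (2 * k) + K * (`|tau| * e n + (v n)^-1) <=
    (Lambda / 2 + Lambda / 4) * tau ^+ (2 * k).
  rewrite mulrDl lerD ?ler_wpM2r//.
  apply: (le_trans _ (ler_wpM2r tau2k0 small)).
  rewrite -mulrA ler_wpM2l// mulrDl lerD//; first by rewrite mulrC ler_wpM2l.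
  by rewrite ler_peMr.
rewrite ler_norml => /andP[+ _]; rewrite lerBrDr; apply: le_trans.
rewrite addrC -mulrBr ler_wpM2l ?(ltW v0)//.
move: error_le; rewrite mulrDl.
move: (tau ^+ (2 * k)) (_ + K * _) => x y; lra.
Unshelve. all: by end_near. Qed.

End rescaled_energy.

(** * Upper and lower bounds on the conditional mass *)

Section rate_function.
Variable R : realType.
Implicit Types (beta lambda x alpha : R) (k n : nat).

(* The optimal tilt at distance [x] from [m] is [tilt_ratio * x]: for [k = 1] the
   mean of the tilted law responds to a unit change of tilt by [1 - lambda / beta]. *)
Definition tilt_ratio beta k lambda : R :=
  if k == 1%N then beta / (beta - lambda) else 1.

Definition admissible beta k lambda : Prop :=
  [/\ 0 < beta, 0 < lambda, (1 <= k)%N & k = 1%N -> lambda < beta].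

Definition strength_coefficient k lambda : R := lambda / ((2 * k)`!)%:R.

Lemma strength_coefficient_gt0 beta k lambda : admissible beta k lambda ->
  0 < strength_coefficient k lambda.
Proof. by case=> _ l0 _ _; rewrite divr_gt0// ltr0n fact_gt0. Qed.

Lemma tilt_ratio_gt0 beta k lambda : admissible beta k lambda ->
  0 < tilt_ratio beta k lambda.
Proof.
case=> b0 l0 _ lb; rewrite /tilt_ratio; case: eqP => // /lb ?.
by rewrite divr_gt0// subr_gt0.
Qed.

Lemma speed1E alpha n : (0 < n)%N -> speed 1 alpha n = gaussian_speed alpha n.
Proof. by move=> n0; rewrite speedE. Qed.

(** Treats both cases at once: the two speeds coincide for [k = 1], and the factor is 0 for
    [k >= 2]. *)
Lemma gaussian_speed_tilt beta k lambda alpha n : (0 < n)%N ->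
  gaussian_speed alpha n * (1 - tilt_ratio beta k lambda) =
  speed k alpha n * (1 - tilt_ratio beta k lambda).
Proof.
move=> n0; rewrite /tilt_ratio; case: eqP => [->|_]; first by rewrite speed1E.
by rewrite subrr !mulr0.
Qed.

(** The left side is minus the exponent of the tilting identity at distance [x] and tilt [c * x].
    For [k = 1] its coefficient is [lambda beta / (2 (beta - lambda)) = 1 / (2 sigma^2)]. *)
Lemma rateE beta k lambda x : admissible beta k lambda ->
  let c := tilt_ratio beta k lambda in
  strength_coefficient k lambda * (c * x) ^+ (2 * k) -
    beta / 2 * (1 - c) ^+ 2 * x ^+ 2 = rate beta k lambda x.
Proof.
case=> b0 l0 _ lb /=; rewrite /tilt_ratio /strength_coefficient /rate.
case: eqP => [k1|_]; last by rewrite mul1r subrr expr0n/= mulr0 mul0r subr0 mulrAC.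
have bl : 0 < beta - lambda by rewrite subr_gt0 lb.
rewrite k1 muln1 (_ : 2`!%:R = 2)//.
have -> : lambda^-1 - beta^-1 = (beta - lambda) / (lambda * beta).
  by field; rewrite !gt_eqF.
by field; rewrite !gt_eqF.
Qed.

Lemma rate_monomial beta k lambda : admissible beta k lambda ->
  exists2 K, 0 < K & forall x, rate beta k lambda x = K * x ^+ (2 * k).
Proof.
case=> b0 l0 _ lb; rewrite /rate; case: eqP => [k1|_].
  have bl : 0 < lambda^-1 - beta^-1.
    by rewrite subr_gt0 ltf_pV2 ?posrE// lb.
  exists (2 * (lambda^-1 - beta^-1))^-1; first by rewrite invr_gt0 mulr_gt0.
  by move=> x; rewrite k1 muln1 mulrC.
exists (lambda / ((2 * k)`!)%:R); first by rewrite divr_gt0// ltr0n fact_gt0.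
by move=> x; rewrite mulrAC.
Qed.

Lemma rate_ge0 beta k lambda x : admissible beta k lambda -> 0 <= rate beta k lambda x.
Proof.
move=> /rate_monomial[K K0 ->].
by rewrite mulr_ge0 ?(ltW K0)// exprM exprn_ge0 ?sqr_ge0.
Qed.

End rate_function.

Section conditional_mass.
Variable R : realType.
Implicit Types (beta lambda x alpha m a : R) (k n : nat) (h : nat -> R).

Definition conditional_mass beta h m alpha a n (C : set R) : R :=
  \sum_(s : config n | (rescaled_magnetization m alpha s \in C) &&
                       (s \in @mean_magnetization_near R m a n)) boltzmann beta h s.

(** The partition function cancels. As the inverse of 0 is 0, the identity includes the case of an
    empty conditioning event. *)
Lemma conditioned_lawE beta h m alpha a n C :
  conditioned_law beta h m alpha a n C =
  (conditional_mass beta h m alpha a n C /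
   conditional_mass beta h m alpha a n setT)%:E.
Proof.
have gibbsE (B : set (config n)) : gibbs beta h B =
    ((\sum_(s : config n | s \in B) boltzmann beta h s) /
     partition_function beta h n)%:E.
  rewrite /gibbs mulr_suml -sumEFin [RHS]big_mkcond/=; apply: eq_bigr => s _.
  by rewrite diracE; case: (s \in B); rewrite ?mule1 ?mule0.
have -> : conditioned_law beta h m alpha a n C =
    (gibbs beta h (rescaled_magnetization m alpha (n:=n) @^-1` C `&`
       @mean_magnetization_near R m a n) *
     ((fine (gibbs beta h (@mean_magnetization_near R m a n)))^-1)%:E)%E by [].
rewrite !gibbsE/= -EFinM; congr EFin.
have Z0 := partition_function_gt0 beta h n.
have -> : \sum_(s : config n | s \in @mean_magnetization_near R m a n) boltzmann beta h s =
    conditional_mass beta h m alpha a n setT.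
  by apply: eq_bigl => s; rewrite (_ : _ \in setT = true)// in_setT.
have -> : \sum_(s : config n | s \in (rescaled_magnetization m alpha (n:=n) @^-1` C `&`
      @mean_magnetization_near R m a n)) boltzmann beta h s =
    conditional_mass beta h m alpha a n C.
  by apply: eq_bigl => s; rewrite in_setI.
by rewrite invfM invrK mulrACA mulVf ?mulr1// gt_eqF.
Qed.

Lemma mean_magnetizationE m alpha n (s : config n) : (0 < n)%N ->
  mean_magnetization R s = m + rescaled_magnetization m alpha s * space_scale alpha n.
Proof.
move=> n0; have nR0 : 0 < n%:R :> R by rewrite ltr0n.
have powS : n%:R `^ alpha = n%:R * space_scale alpha n.
  rewrite /space_scale -{2}(powRr1 (ltW nR0)) -powRD ?(gt_eqF nR0) ?implybT//.
  by rewrite addrC subrK.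
have r0 := space_scale_gt0 alpha n0.
rewrite /rescaled_magnetization /mean_magnetization powS; field.
by rewrite !gt_eqF.
Qed.

Definition energy_increment beta h m n (t : R) : R :=
  empirical_energy beta h n (m + t) - empirical_energy beta h n m.

(** Collects the energy at [m], of which only increments are controlled; it cancels in the
    conditional law. *)
Definition mass_scale beta h m n : R :=
  2 ^+ n * expR (- (n%:R * empirical_energy beta h n m)).

Lemma mass_scale_gt0 beta h m n : 0 < mass_scale beta h m n.
Proof. by rewrite mulr_gt0 ?exprn_gt0// expR_gt0. Qed.

Section bounds.
Variables (beta : R) (h : nat -> R) (m : R) (k : nat) (lambda alpha : R).
Variables (C K delta : R) (N : nat).

Local Notation r := (space_scale alpha).
Local Notation v := (speed k alpha).
Local Notation w := (gaussian_speed alpha).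
Local Notation gn := (energy_increment beta h m).
Local Notation Lambda := (strength_coefficient k lambda).
Local Notation c := (tilt_ratio beta k lambda).
Local Notation I := (rate beta k lambda).
Local Notation mass := (conditional_mass beta h m alpha).

(** The optimal tilt [c * x] yields the rate where the expansion is uniform. Far out, the cruder
    tilt at [S/n] itself removes the square, and the tail bound on the energy already exceeds
    [l]. *)
Lemma conditional_mass_le (A a l eps : R) (D : set R) :
    admissible beta k lambda -> 0 <= C -> 0 <= K -> 0 < delta ->
    moderate_range k alpha -> empirical_expansion gn k Lambda C K delta N ->
    (\forall n \near \oo, forall tau, 1 <= `|tau| -> `|tau * r n| <= A ->
      v n * (Lambda / 4 * tau ^+ (2 * k)) <= n%:R * gn n (tau * r n)) ->
    a <= A -> 0 < eps -> (forall x, D x -> l <= I x) ->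
  \forall n \near \oo,
    mass a n D <= mass_scale beta h m n * (n.+1%:R * expR (- (v n * (l - eps)))).
Proof.
move=> adm C0 K0 delta0 range expansion tail aA eps0 Dl.
have Lambda0 := strength_coefficient_gt0 adm.
have c0 := tilt_ratio_gt0 adm; have [beta0 _ k1 _] := adm.
(* [M >= 1] opens the tail bound, and [Lambda / 4 * M >= l] makes it sufficient, since
   [|x| <= x^(2 k)]. *)
pose M := Num.max 1 (4 * l / Lambda).
have M1 : 1 <= M by rewrite le_max lexx.
have Ml : l <= Lambda / 4 * M.
  apply: (@le_trans _ _ (Lambda / 4 * (4 * l / Lambda))).
    by rewrite le_eqVlt; apply/orP; left; apply/eqP; field; rewrite gt_eqF.
  rewrite ler_wpM2l//; first by rewrite divr_ge0 ?(ltW Lambda0).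
  by rewrite /M le_max lexx orbT.
have cM0 : 0 <= c * M by rewrite mulr_ge0 ?(ltW c0)// (le_trans ler01).
near=> n.
have n0 : (0 < n)%N by near: n; exact: nbhs_infty_gt.
have r0 := space_scale_gt0 alpha n0; have v0 := speed_gt0 k alpha n0.
have bulk : forall tau, `|tau| <= c * M ->
    `|n%:R * gn n (tau * r n) - v n * (Lambda * tau ^+ (2 * k))| <= v n * eps.
  by near: n; apply: (rescaled_energy_cvg C0 K0 delta0 range expansion).
have far : forall tau, 1 <= `|tau| -> `|tau * r n| <= A ->
    v n * (Lambda / 4 * tau ^+ (2 * k)) <= n%:R * gn n (tau * r n).
  by near: n.
pose tau (y : R) := let x := (y - m) / r n in
  m + (if `|x| <= M then c * x else x) * r n.
rewrite /mass_scale mulrACA -expRD.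
apply: (sum_boltzmann_le (tau := tau) n0) => s /andP[sD sa] /=.
rewrite (mean_magnetizationE m alpha s n0).
set x := rescaled_magnetization m alpha s.
have Dx : D x by rewrite inE in sD.
have xa : `|x * r n| <= A.
  apply: le_trans aA; move: sa; rewrite inE /mean_magnetization_near /=.
  rewrite -/(mean_magnetization R s) (mean_magnetizationE m alpha s n0) -/x in_itv/=.
  by rewrite !lerD2l ler_norml.
rewrite /tau [m + x * r n - m]addrAC subrr add0r mulfK ?gt_eqF//.
set u := if _ then _ else _.
have -> : n%:R * (beta / 2 * (m + x * r n - (m + u * r n)) ^+ 2 -
      empirical_energy beta h n (m + u * r n)) =
    - (n%:R * empirical_energy beta h n m) +
    (w n * (beta / 2 * (x - u) ^+ 2) - n%:R * gn n (u * r n)).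
  rewrite /gaussian_speed /energy_increment; ring.
rewrite lerD2l /u; case: ifPn => [xM|]; last first.
  rewrite -ltNge => Mx; rewrite subrr expr0n/= !mulr0 sub0r lerN2.
  have x1 : 1 <= `|x| by rewrite (le_trans M1)// ltW.
  apply: le_trans (far _ x1 xa); rewrite ler_wpM2l ?(ltW v0)//.
  have x2k : `|x| <= x ^+ (2 * k) by exact: ler_norm_exprn_even.
  apply: (@le_trans _ _ l); first by rewrite gerBl ltW.
  apply: (le_trans Ml); apply: ler_wpM2l; first by rewrite divr_ge0 ?(ltW Lambda0).
  exact: le_trans (ltW Mx) x2k.
have cx : `|c * x| <= c * M by rewrite normrM (gtr0_norm c0) ler_wpM2l ?(ltW c0).
have := bulk _ cx; rewrite ler_norml => /andP[+ _].
have := rateE x adm; rewrite /= => rate_x.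
have quadratic : w n * (beta / 2 * (x - c * x) ^+ 2) =
    v n * (beta / 2 * (1 - c) ^+ 2 * x ^+ 2).
  have -> : w n * (beta / 2 * (x - c * x) ^+ 2) =
    w n * (1 - c) * (beta / 2 * (1 - c) * x ^+ 2) by ring.
  by rewrite gaussian_speed_tilt//; ring.
rewrite quadratic.
have : v n * l <= v n * I x by rewrite ler_wpM2l ?(ltW v0)// Dl.
rewrite -rate_x !(mulrBr (v n)).
move: (v n * (Lambda * _)) (v n * (beta / 2 * _ * _)) (n%:R * gn n _).
move: (v n * l) (v n * eps) => vl ve p q g; lra.
Unshelve. all: by end_near. Qed.

(* The first-order terms in [z] cancel by the choice of [c]. *)
Lemma deviation_exponent_le (x z : R) :
    admissible beta k lambda -> moderate_range k alpha -> z != 0 ->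
  \forall n \near \oo,
    w n * (beta / 2 * (- z ^+ 2 - 2 * z * (1 - c) * x)) +
    v n * (Lambda * (c * x) ^+ (2 * k) - Lambda * (c * x + z) ^+ (2 * k)) <=
    - (w n * (3 / 8 * beta * z ^+ 2)).
Proof.
move=> adm range z0; have [beta0 lambda0 k1 lb] := adm.
have z2 : 0 < z ^+ 2 by rewrite exprn_even_gt0.
have coef0 q : 0 < q -> 0 < q * beta * z ^+ 2.
  by move=> q0; apply: mulr_gt0 => //; exact: mulr_gt0.
have [k_eq1|k_neq1] := eqVneq k 1%N.
  near=> n.
  have n0 : (0 < n)%N by near: n; exact: nbhs_infty_gt.
  have w0 := gaussian_speed_gt0 alpha n0.
  have bl : 0 < beta - lambda by rewrite subr_gt0 lb.
  have cE : tilt_ratio beta 1 lambda = beta / (beta - lambda) by [].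
  rewrite /strength_coefficient k_eq1 speed1E// cE (_ : (2 * 1)`!%:R = 2)// muln1.
  (* Exact cancellation of the terms linear in [z] for [k = 1]. *)
  have -> : w n * (beta / 2 * (- z ^+ 2 - 2 * z * (1 - beta / (beta - lambda)) * x)) +
      w n * (lambda / 2 * (beta / (beta - lambda) * x) ^+ 2 -
             lambda / 2 * (beta / (beta - lambda) * x + z) ^+ 2) =
      - (w n * ((beta + lambda) / 2 * z ^+ 2)).
    by field; rewrite gt_eqF.
  rewrite lerN2 ler_wpM2l ?(ltW w0)// ler_wpM2r ?(ltW z2)//.
  by lra.
have k2 : (1 < k)%N by rewrite ltn_neqAle eq_sym k_neq1.
(* For [k >= 2] the cross term vanishes with [1 - c], and the energy difference, of smaller speed,
   costs at most [1/8] of the coefficient [1/2]. *)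
pose d := Lambda * (c * x) ^+ (2 * k) - Lambda * (c * x + z) ^+ (2 * k).
have c1 : c = 1 by rewrite /tilt_ratio (negbTE k_neq1).
have dvw : d * (v n / w n) @[n --> \oo] --> (0 : R).
  rewrite -[X in _ --> X](mulr0 d); apply: cvgMr.
  exact: speed_div_gaussian_speed_cvg range k2.
have bz : 0 < 8^-1 * beta * z ^+ 2 by exact: coef0.
have small := (cvgr0Pnorm_le _).1 dvw _ bz.
near=> n.
have n0 : (0 < n)%N by near: n; exact: nbhs_infty_gt.
have w0 := gaussian_speed_gt0 alpha n0.
have : d * (v n / w n) <= 8^-1 * beta * z ^+ 2.
  by apply: le_trans (ler_norm _) _; near: n; exact: small.
rewrite mulrA ler_pdivrMr// [d * _]mulrC => vd.
rewrite -/d c1 subrr mulr0 mul0r subr0; apply: (le_trans (lerD (lexx _) vd)).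
by rewrite le_eqVlt; apply/orP; left; apply/eqP; field.
Unshelve. all: by end_near. Qed.

(** The law tilted at [m + c * x * r n] concentrates around [m + x * r n]. With [1/4] on each side,
    half of its mass stays in the window. *)
Lemma deviation_bound_small (x z : R) :
    admissible beta k lambda -> 0 <= C -> 0 <= K -> 0 < delta ->
    moderate_range k alpha -> empirical_expansion gn k Lambda C K delta N ->
    z != 0 ->
  \forall n \near \oo,
    deviation_bound beta h n (m + c * x * r n) (m + x * r n) (z * r n) <= 4^-1.
Proof.
move=> adm C0 K0 delta0 range expansion z0.
have [beta0 _ _ _] := adm.
have z2 : 0 < z ^+ 2 by rewrite exprn_even_gt0.
have coef0 q : 0 < q -> 0 < q * beta * z ^+ 2.
  by move=> q0; apply: mulr_gt0 => //; exact: mulr_gt0.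
have bz8 : 0 < 8^-1 * beta * z ^+ 2 by exact: coef0.
pose T := `|c * x| + `|z|.
have T0 : 0 <= T by rewrite addr_ge0.
have exponent := deviation_exponent_le x adm range z0.
(* Two energy errors with coefficient [1/16], at speed [v n <= w n], leave [1/4] of the [3/8]; [1/8]
   is enough below. *)
have eps0 : 0 < 16^-1 * beta * z ^+ 2 by exact: coef0.
have bulk := rescaled_energy_cvg C0 K0 delta0 range expansion T0 eps0.
(* This makes the final exponent at least 4, and [expR 4 >= 4]. *)
have ln4 : 0 < (8^-1 * beta * z ^+ 2) / 4 by rewrite divr_gt0.
have inv_w := (cvgr0Pnorm_le _).1 (inv_gaussian_speed_cvg range) _ ln4.
have r_small := (cvgr0Pnorm_le _).1 (space_scale_cvg range) _ ltr01.
near=> n.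
have n0 : (0 < n)%N by near: n; exact: nbhs_infty_gt.
have w0 := gaussian_speed_gt0 alpha n0; have v0 := speed_gt0 k alpha n0.
have r0 := space_scale_gt0 alpha n0.
rewrite /deviation_bound.
have -> : n%:R * (beta / 2 * (- (z * r n) ^+ 2 -
      2 * (z * r n) * (m + x * r n - (m + c * x * r n))) +
      empirical_energy beta h n (m + c * x * r n) -
      empirical_energy beta h n (m + c * x * r n + z * r n)) =
    w n * (beta / 2 * (- z ^+ 2 - 2 * z * (1 - c) * x)) +
    (n%:R * gn n (c * x * r n) - n%:R * gn n ((c * x + z) * r n)).
  have -> : m + c * x * r n + z * r n = m + (c * x + z) * r n by ring.
  by rewrite /gaussian_speed /energy_increment; ring.
have bulk_n : forall tau, `|tau| <= T ->
    `|n%:R * gn n (tau * r n) - v n * (Lambda * tau ^+ (2 * k))| <=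
      v n * (16^-1 * beta * z ^+ 2).
  by near: n; exact: bulk.
have b1 : `|c * x| <= T by rewrite /T lerDl.
have b2 : `|c * x + z| <= T by exact: ler_normD.
have := bulk_n _ b1; have := bulk_n _ b2; rewrite !ler_norml => /andP[B1 _] /andP[_ B2].
have E : w n * (beta / 2 * (- z ^+ 2 - 2 * z * (1 - c) * x)) +
    v n * (Lambda * (c * x) ^+ (2 * k) - Lambda * (c * x + z) ^+ (2 * k)) <=
    - (w n * (3 / 8 * beta * z ^+ 2)).
  by near: n; exact: exponent.
have inv_w_n : (w n)^-1 <= (8^-1 * beta * z ^+ 2) / 4.
  by apply: le_trans (ler_norm _) _; near: n; exact: inv_w.
have vw : v n <= w n.
  have r1 : r n <= 1 by apply: le_trans (ler_norm _) _; near: n; exact: r_small.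
  rewrite speedE// ler_wpM2l// ler_wiXn2l ?(ltW r0)//.
  by have [k1 _] := range; exact: (leq_mul (leqnn 2) k1).
apply: (@le_trans _ _ (expR (- (w n * (8^-1 * beta * z ^+ 2))))).
  rewrite ler_expR.
  have : v n * (16^-1 * beta * z ^+ 2) <= w n * (16^-1 * beta * z ^+ 2).
    by rewrite ler_wpM2r ?(ltW eps0).
  have : w n * (8^-1 * beta * z ^+ 2) =
    (w n * (3 / 8 * beta * z ^+ 2)) - 2 * (2 * (w n * (16^-1 * beta * z ^+ 2))).
    by field.
  have : 0 < w n * (16^-1 * beta * z ^+ 2) by rewrite mulr_gt0.
  move: E B1 B2; rewrite (mulrBr (v n)).
  move: (w n * (8^-1 * _ * _)) (w n * (3 / 8 * _ * _)) (w n * (16^-1 * _ * _)).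
  move: (v n * (16^-1 * _ * _)) => a b e f.
  move: (w n * _) => X; move: (v n * _) => P; move: (v n * _) => Q.
  move: (n%:R * _) => g1; move: (n%:R * _) => g2; lra.
have w8 : 4 <= w n * (8^-1 * beta * z ^+ 2).
  move: inv_w_n; rewrite ler_pdivlMr// mulrC ler_pdivrMr//; lra.
rewrite expRN lef_pV2 ?posrE ?expR_gt0//.
apply: (le_trans w8); apply: le_trans (expR_ge1Dx _).
by rewrite lerDr.
Unshelve. all: by end_near. Qed.

Lemma conditional_mass_ge (a eps x : R) (D : set R) :
    admissible beta k lambda -> 0 <= C -> 0 <= K -> 0 < delta ->
    moderate_range k alpha -> empirical_expansion gn k Lambda C K delta N ->
    0 < a -> 0 < eps -> nbhs x D ->
  \forall n \near \oo,
    mass_scale beta h m n * (2^-1 * expR (- (v n * (I x + eps)))) <= mass a n D.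
Proof.
move=> adm C0 K0 delta0 range expansion a0 eps0 xD.
have c0 := tilt_ratio_gt0 adm; have [beta0 _ k1 _] := adm.
(* The rescaled distance from the tilt [c * x] to the target [x]; it is 0 for [k >= 2]. *)
have [q qE] : exists q, q = (1 - c) * x by exists ((1 - c) * x).
(* The window must lie in [D] and lose at most [eps / 2] in the square; the other [eps / 2] pays for
   the energy. The [+ 1] in the denominator allows [q = 0]. *)
have [eta [eta0 etaD eta_eps]] : exists eta, [/\ 0 < eta,
    forall z, `|z - x| < eta -> D z & beta * `|q| * eta <= eps / 2].
  have /nbhs_ballP[eta0 /= eta0_gt0 ballD] := xD.
  have bq0 : 0 < beta * `|q| + 1 by rewrite ltr_wpDl// mulr_ge0 ?(ltW beta0).
  exists (Num.min eta0 (eps / 2 / (beta * `|q| + 1))); split.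
  - by rewrite lt_min eta0_gt0 !divr_gt0.
  - move=> z; rewrite lt_min => /andP[zx _]; apply: ballD.
    by rewrite -ball_normE/= distrC.
  apply: (@le_trans _ _ ((beta * `|q| + 1) * (eps / 2 / (beta * `|q| + 1)))).
    rewrite ler_pM ?mulr_ge0 ?(ltW beta0) ?lerDl//.
      by rewrite le_min (ltW eta0_gt0) !divr_ge0 ?(ltW bq0) ?(ltW eps0).
    by rewrite ge_min lexx orbT.
  by rewrite mulrC mulfVK// gt_eqF.
have half_le (p s : R) : p <= 4^-1 -> s <= 4^-1 -> 2^-1 <= 1 - p - s by lra.
have arith (e1 e2 e3 e4 e5 : R) : e2 <= e1 -> e4 - e5 <= e1 ->
    - (e5 - e3 + e1 + e1) <= e3 - e2 - e4 by lra.
have Neta0 : - eta != 0 by rewrite oppr_eq0 gt_eqF.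
have eta_neq0 : eta != 0 by rewrite gt_eqF.
have dev1 := deviation_bound_small x adm C0 K0 delta0 range expansion eta_neq0.
have dev2 := deviation_bound_small x adm C0 K0 delta0 range expansion Neta0.
have eps20 : 0 < eps / 2 by rewrite divr_gt0.
have bulk := rescaled_energy_cvg C0 K0 delta0 range expansion (normr_ge0 (c * x)) eps20.
have xr_cvg : (`|x| + eta) * r n @[n --> \oo] --> (0 : R).
  rewrite -[X in _ --> X](mulr0 (`|x| + eta)); apply: cvgMr.
  exact: space_scale_cvg range.
have xr_small := (cvgr0Pnorm_le _).1 xr_cvg _ a0.
near=> n.
have n0 : (0 < n)%N by near: n; exact: nbhs_infty_gt.
have r0 := space_scale_gt0 alpha n0; have v0 := speed_gt0 k alpha n0.
have xr : (`|x| + eta) * r n <= a.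
  by apply: le_trans (ler_norm _) _; near: n; exact: xr_small.
have [d1 d2'] :
    deviation_bound beta h n (m + c * x * r n) (m + x * r n) (eta * r n) <= 4^-1 /\
    deviation_bound beta h n (m + c * x * r n) (m + x * r n) (- eta * r n) <= 4^-1.
  by near: n; exact: filterI dev1 dev2.
have d2 : deviation_bound beta h n (m + c * x * r n) (m + x * r n) (- (eta * r n))
    <= 4^-1.
  by rewrite -(mulNr eta (r n)).
have bulk_n : forall tau, `|tau| <= `|c * x| ->
    `|n%:R * gn n (tau * r n) - v n * (Lambda * tau ^+ (2 * k))| <= v n * (eps / 2).
  by near: n; exact: bulk.
have etar0 : 0 <= eta * r n by rewrite mulr_ge0 ?(ltW eta0) ?(ltW r0).
have near_y s : `|mean_magnetization R s - (m + x * r n)| < eta * r n ->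
    (rescaled_magnetization m alpha s \in D) &&
      (s \in @mean_magnetization_near R m a n) /\
    r n ^+ 2 * (q ^+ 2 - 2 * (eta * `|q|)) <=
      (mean_magnetization R s - (m + c * x * r n)) ^+ 2.
  have sE := mean_magnetizationE m alpha s n0; rewrite sE.
  move: (rescaled_magnetization m alpha s) sE => z sE.
  have -> : m + z * r n - (m + x * r n) = (z - x) * r n by ring.
  rewrite normrM (gtr0_norm r0) ltr_pM2r// => zx.
  split.
    apply/andP; split; first by rewrite inE; exact: etaD.
    rewrite inE /mean_magnetization_near /= -/(mean_magnetization R s) sE in_itv/=.
    rewrite !lerD2l -ler_norml normrM (gtr0_norm r0) (le_trans _ xr)//.
    rewrite ler_wpM2r ?(ltW r0)//.
    have -> : z = x + (z - x) by ring.
    by rewrite (le_trans (ler_normD _ _))// lerD2l ltW.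
  have -> : m + z * r n - (m + c * x * r n) = r n * (z - x + q) by rewrite qE; ring.
  rewrite exprMn ler_wpM2l ?sqr_ge0//.
  have uq : - (eta * `|q|) <= (z - x) * q.
    rewrite lerNl (le_trans (ler_norm _))// normrN normrM ler_wpM2r// ltW//.
  have -> : (z - x + q) ^+ 2 = (z - x) ^+ 2 + 2 * ((z - x) * q) + q ^+ 2 by ring.
  rewrite addrC lerD2r; apply: (@le_trans _ _ (2 * ((z - x) * q))).
    by rewrite -mulrN ler_wpM2l.
  by rewrite lerDr sqr_ge0.
have := @sum_boltzmann_ge R beta h n (fun s =>
  (rescaled_magnetization m alpha s \in D) && (s \in @mean_magnetization_near R m a n))
  _ _ _ _ n0 (ltW beta0) etar0 near_y.
apply: le_trans.
rewrite /mass_scale -(mulrA (2 ^+ n)) -[leRHS]mulrA ler_wpM2l ?exprn_ge0//.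
rewrite mulrCA [leRHS]mulrC.
apply: ler_pM; rewrite ?mulr_ge0 ?expR_ge0//; first exact: half_le.
rewrite -expRD ler_expR.
have -> : n%:R * (beta / 2 * (r n ^+ 2 * (q ^+ 2 - 2 * (eta * `|q|))) -
      empirical_energy beta h n (m + c * x * r n)) =
    - (n%:R * empirical_energy beta h n m) +
    (beta / 2 * (w n * q ^+ 2) - w n * `|q| * (beta * eta) - n%:R * gn n (c * x * r n)).
  by rewrite /gaussian_speed /energy_increment; field.
rewrite lerD2l.
(* [q] carries the factor [1 - c], so the Gaussian speed may be exchanged for [v n]. *)
have wq2 : w n * q ^+ 2 = v n * q ^+ 2.
  have -> : w n * q ^+ 2 = w n * (1 - c) * (1 - c) * x ^+ 2 by rewrite qE; ring.
  by rewrite gaussian_speed_tilt// qE; ring.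
have wq : w n * `|q| = v n * `|q|.
  have w0 := gaussian_speed_gt0 alpha n0.
  rewrite -[w n in LHS](gtr0_norm w0) -[v n in RHS](gtr0_norm v0) -!normrM qE !mulrA.
  by rewrite gaussian_speed_tilt.
have := bulk_n (c * x) (lexx _); rewrite ler_norml => /andP[_ +].
rewrite wq2 wq -(rateE x adm) /=.
have -> : beta / 2 * (1 - c) ^+ 2 * x ^+ 2 = beta / 2 * q ^+ 2 by rewrite qE; ring.
have : v n * (beta * `|q| * eta) <= v n * (eps / 2) by rewrite ler_wpM2l ?(ltW v0).
have -> : v n * `|q| * (beta * eta) = v n * (beta * `|q| * eta) by ring.
have -> : beta / 2 * (v n * q ^+ 2) = v n * (beta / 2 * q ^+ 2) by ring.
have -> : v n * (Lambda * (c * x) ^+ (2 * k) - beta / 2 * q ^+ 2 + eps) =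
    v n * (Lambda * (c * x) ^+ (2 * k)) - v n * (beta / 2 * q ^+ 2) + v n * (eps / 2)
    + v n * (eps / 2) by field.
move: (v n * (eps / 2)) (v n * (beta * _ * _)) (v n * (beta / 2 * _)) => e1 e2 e3.
move: (n%:R * _) => e4; move: (v n * _) => e5; exact: arith.
Unshelve. all: by end_near. Qed.

End bounds.
End conditional_mass.

(** * Moderate deviations *)

Section limits.
Variable R : realType.
Local Open Scope ereal_scope.

Lemma limn_esup_le_near (u : nat -> \bar R) (l : \bar R) :
  (\forall n \near \oo, u n <= l) -> limn_esup u <= l.
Proof.
move=> ul; apply: (@le_trans _ _ (ereal_sup [set u n | n in [set n | u n <= l]])).
  by apply: ereal_inf_lbound; exists [set n | u n <= l].
by apply: ge_ereal_sup => _ [n /= unl <-].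
Qed.

Lemma limn_einf_ge_near (u : nat -> \bar R) (l : \bar R) :
  (\forall n \near \oo, l <= u n) -> l <= limn_einf u.
Proof.
move=> lu; rewrite /limn_einf leeNr; apply: limn_esup_le_near.
by apply: filterS lu => n /=; rewrite leeN2.
Qed.

End limits.

Section deviations.
Variable R : realType.

Lemma compact_monomial_sublevel (K c : R) (k : nat) : 0 < K -> (1 <= k)%N ->
  compact [set x | (K * x ^+ (2 * k))%:E <= c%:E]%E.
Proof.
move=> K0 k1; pose M := 1 + `|c / K|.
apply: (@subclosed_compact _ _ `[- M, M]%classic) => //; last first.
- move=> x /=; rewrite lee_fin in_itv/= -ler_norml mulrC -ler_pdivlMr// => xc.
  have [x1|x1] := leP `|x| 1; first by rewrite (le_trans x1)// lerDl.
  have x2k : `|x| <= x ^+ (2 * k) by apply: ler_norm_exprn_even => //; exact: ltW.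
  rewrite (le_trans x2k)// (le_trans xc)// (le_trans (ler_norm _))//.
  by rewrite lerDr.
- exact: segment_compact.
rewrite (_ : [set x | _] = (fun x => K * x ^+ (2 * k)) @^-1` [set y | y <= c]); last first.
  by apply/seteqP; split => x /=; rewrite lee_fin.
apply: closed_comp; last exact: closed_le.
move=> x _; apply: cvgMr; exact: exprn_continuous.
Qed.

Lemma lower_semicontinuous_EFin (f : R -> R) : continuous f ->
  lower_semicontinuous (EFin \o f).
Proof.
move=> cf x a; rewrite lte_fin => afx.
exists [set y | a < f y]; last by move=> y; rewrite /= lte_fin.
by have /cvgr_gt/(_ _ afx) := cf x.
Qed.

(** Real exponential bounds suffice: a lower one at each interior point, an upper one for each real
    [l] below the rate on [D]. The extended reals are confined to this proof. *)
Lemma deviations_principle_of_mass (mu : nat -> {measure set R -> \bar R})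
    (a : nat -> R) (I : R -> R) :
    lower_semicontinuous (EFin \o I) ->
    (forall c : R, compact [set x | (I x)%:E <= c%:E]%E) ->
    (\forall n \near \oo, 0 < a n) ->
    (forall (D : set R) (x eps : R), nbhs x D -> 0 < eps ->
      \forall n \near \oo, exists2 q : R, mu n D = q%:E &
        expR (- (a n * (I x + eps))) <= q) ->
    (forall (D : set R) (l eps : R), (forall x, D x -> l <= I x) -> 0 < eps ->
      \forall n \near \oo, exists2 q : R, mu n D = q%:E &
        q <= expR (- (a n * (l - eps)))) ->
  deviations_principle mu a (EFin \o I).
Proof.
move=> lsc good apos lower upper; split=> // D mD u.
split; last 1 first.
- have key (l eps : R) : (forall x, D x -> l <= I x) -> 0 < eps ->
      (limn_esup u <= (- l)%:E + eps%:E)%E.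
    move=> Dl eps0; apply: limn_esup_le_near.
    near=> n.
    have an : 0 < a n by near: n.
    have [q muq q_le] : exists2 q : R, mu n D = q%:E & q <= expR (- (a n * (l - eps))).
      by near: n; exact: upper.
    rewrite /u muq.
    have [q0|q0] := leP q 0.
      by rewrite le0_lneNy ?lee_fin// gt0_muleNy ?leNye// lte_fin invr_gt0.
    rewrite lne_EFin// -EFinM -EFinD lee_fin ler_pdivrMl//.
    rewrite -ler_expR lnK ?posrE// (le_trans q_le)// ler_expR.
    by rewrite le_eqVlt; apply/orP; left; apply/eqP; ring.
  (* The infimum over the closure is a lower bound on [D] itself, to which the upper estimate
     applies. *)
  set S := ereal_inf _.
  have SI x : D x -> (S <= (I x)%:E)%E.
    by move=> Dx; apply: ereal_inf_lbound; exists x => //; exact: subset_closure.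
  move: SI; case: S => [s||] SI; last by rewrite leey.
    apply/lee_addgt0Pr => eps eps0; rewrite -EFinN.
    by apply: key => // x /SI.
  (* For an infimum [+oo] every real is a lower bound of the rate on [D], so the upper limit lies
     below every real. *)
  have esup_le (l : R) : (limn_esup u <= l%:E)%E.
    have := @key (1 - l) 1; rewrite -EFinD opprB subrK; apply => // x /SI.
    by rewrite leye_eq.
  move: esup_le; case: (limn_esup u) => [r||] // esup_le.
    by have := esup_le (r - 1); rewrite lee_fin leNgt ltrBlDr ltrDl ltr01.
  by have := esup_le 0; rewrite leye_eq.
- rewrite leeNl; apply: le_ereal_inf_tmp => _ [x Dx <-]; rewrite leeNl -EFinN.
  apply/lee_addgt0Pr => eps eps0; rewrite -leeBlDr//; apply: limn_einf_ge_near.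
  near=> n.
  have an : 0 < a n by near: n.
  have [q muq q_ge] : exists2 q : R, mu n D = q%:E & expR (- (a n * (I x + eps))) <= q.
    by near: n; exact: lower.
  have q0 : 0 < q by apply: lt_le_trans q_ge; exact: expR_gt0.
  rewrite /u muq lne_EFin// -EFinM -EFinB lee_fin ler_pdivlMl//.
  rewrite -ler_expR lnK ?posrE// (le_trans _ q_ge)// ler_expR.
  by rewrite le_eqVlt; apply/orP; left; apply/eqP; ring.
- exact: limn_einf_sup.
Unshelve. all: by end_near. Qed.

End deviations.

Section moderate_deviations.
Variable R : realType.

(** The denominator is the mass of the whole line, where the rate has its minimum 0 at [x = 0]. In
    each bound [eps] is split in three: numerator, denominator and the prefactor [2 * n.+1]. *)
Lemma conditioned_law_deviations (beta : R) (h : nat -> R) (m : R) k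
    (lambda alpha C K delta A a : R) N :
    admissible beta k lambda -> 0 <= C -> 0 <= K -> 0 < delta ->
    moderate_range k alpha ->
    empirical_expansion (energy_increment beta h m) k
      (strength_coefficient k lambda) C K delta N ->
    A <= delta -> A <= strength_coefficient k lambda / (2 * (C + 1)) ->
    0 < a -> a <= A ->
  deviations_principle (conditioned_law beta h m alpha a) (speed k alpha)
    (fun x => (rate beta k lambda x)%:E).
Proof.
move=> adm C0 K0 delta0 range expansion A_delta A_le a0 aA.
have [Kr Kr0 rate_K] := rate_monomial adm.
have [_ _ k1 _] := adm.
have tail := rescaled_energy_tail C0 K0 A_delta range expansion
  (strength_coefficient_gt0 adm) A_le.
pose mass := conditional_mass beta h m alpha a.
pose W := mass_scale beta h m.
have W0 n : 0 < W n by exact: mass_scale_gt0.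
have mass_ge D x eps : nbhs x D -> 0 < eps -> \forall n \near \oo,
    W n * (2^-1 * expR (- (speed k alpha n * (rate beta k lambda x + eps)))) <= mass n D.
  by move=> xD eps0; exact: (conditional_mass_ge adm C0 K0 delta0 range expansion).
have mass_le D l eps : (forall x, D x -> l <= rate beta k lambda x) -> 0 < eps ->
    \forall n \near \oo,
    mass n D <= W n * (n.+1%:R * expR (- (speed k alpha n * (l - eps)))).
  by move=> Dl eps0; exact: (conditional_mass_le adm C0 K0 delta0 range expansion tail aA).
have rate0 : rate beta k lambda 0 = 0.
  by rewrite rate_K expr0n muln_eq0/= (gtn_eqF k1) mulr0.
have speed_ge eps : 0 < eps -> \forall n \near \oo,
    2 * n.+1%:R <= expR (speed k alpha n * eps).
  move=> eps0; have small := (cvgr0Pnorm_le _).1 (ln_div_speed_cvg range) _ eps0.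
  near=> n.
  have n0 : (0 < n)%N by near: n; exact: nbhs_infty_gt.
  have : ln (2 * n.+1%:R) / speed k alpha n <= eps.
    by apply: le_trans (ler_norm _) _; near: n; exact: small.
  rewrite ler_pdivrMr ?speed_gt0// [eps * _]mulrC => ln_le.
  have n2 : 0 < 2 * n.+1%:R :> R by rewrite mulr_gt0.
  by rewrite -[leLHS]lnK ?posrE// ler_expR.
have nbhsT (x : R) : nbhs x [set: R] by apply: filterT.
apply: deviations_principle_of_mass.
- apply: lower_semicontinuous_EFin => x.
  rewrite (_ : rate beta k lambda = fun x => Kr * x ^+ (2 * k)); last exact/funext.
  by apply: cvgMr; exact: exprn_continuous.
- move=> c; under eq_set do rewrite rate_K.
  exact: compact_monomial_sublevel.
- by near=> n; apply: speed_gt0; near: n; exact: nbhs_infty_gt.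
- move=> D x eps xD eps0; have e0 : 0 < eps / 3 by rewrite divr_gt0.
  have rate_nonneg y : setT y -> 0 <= rate beta k lambda y by move=> _; exact: rate_ge0.
  have loD := mass_ge D x _ xD e0; have loT := mass_ge setT x _ (nbhsT x) e0.
  have upT := mass_le setT 0 _ rate_nonneg e0; have two_n := speed_ge _ e0.
  near=> n.
  have lo : W n * (2^-1 * expR (- (speed k alpha n * (rate beta k lambda x + eps / 3))))
      <= mass n D by near: n; exact: loD.
  have up : mass n setT <= W n * (n.+1%:R * expR (- (speed k alpha n * (0 - eps / 3)))).
    by near: n; exact: upT.
  have posT : W n * (2^-1 * expR (- (speed k alpha n * (rate beta k lambda x + eps / 3))))
      <= mass n setT by near: n; exact: loT.
  have big : 2 * n.+1%:R <= expR (speed k alpha n * (eps / 3)) by near: n; exact: two_n.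
  have massT0 : 0 < mass n setT.
    by apply: lt_le_trans posT; rewrite mulr_gt0// mulr_gt0 ?expR_gt0.
  exists (mass n D / mass n setT); first exact: conditioned_lawE.
  rewrite ler_pdivlMr// (le_trans _ lo)// (le_trans (ler_wpM2l (expR_ge0 _) up))//.
  rewrite mulrCA ler_wpM2l ?(ltW (W0 n))// mulrCA -expRD.
  have -> : - (speed k alpha n * (rate beta k lambda x + eps / 3)) =
    speed k alpha n * (eps / 3) +
      - (speed k alpha n * (rate beta k lambda x + 2 * (eps / 3))) by ring.
  rewrite [X in _ <= _ * X]expRD [leRHS]mulrA.
  have -> : - (speed k alpha n * (rate beta k lambda x + eps)) +
      - (speed k alpha n * (0 - eps / 3)) =
    - (speed k alpha n * (rate beta k lambda x + 2 * (eps / 3))) by field.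
  by rewrite ler_wpM2r ?expR_ge0// ler_pdivlMl.
- move=> D l eps Dl eps0; have e0 : 0 < eps / 3 by rewrite divr_gt0.
  have upD := mass_le D l _ Dl e0; have loT := mass_ge setT 0 _ (nbhsT 0) e0.
  have two_n := speed_ge _ e0.
  near=> n.
  have up : mass n D <= W n * (n.+1%:R * expR (- (speed k alpha n * (l - eps / 3)))).
    by near: n; exact: upD.
  have lo : W n * (2^-1 * expR (- (speed k alpha n * (rate beta k lambda 0 + eps / 3))))
      <= mass n setT by near: n; exact: loT.
  have big : 2 * n.+1%:R <= expR (speed k alpha n * (eps / 3)) by near: n; exact: two_n.
  have massT0 : 0 < mass n setT.
    by apply: lt_le_trans lo; rewrite mulr_gt0// mulr_gt0 ?expR_gt0.
  exists (mass n D / mass n setT); first exact: conditioned_lawE.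
  rewrite ler_pdivrMr// (le_trans up)// (le_trans _ (ler_wpM2l (expR_ge0 _) lo))//.
  rewrite [leRHS]mulrCA ler_wpM2l ?(ltW (W0 n))// [leRHS]mulrCA -expRD rate0.
  have -> : - (speed k alpha n * (l - eps)) + - (speed k alpha n * (0 + eps / 3)) =
    speed k alpha n * (eps / 3) + - (speed k alpha n * (l - eps / 3)) by field.
  rewrite [X in _ <= _ * X]expRD [leRHS]mulrA.
  by rewrite ler_wpM2r ?expR_ge0// ler_pdivlMl.
Unshelve. all: by end_near. Qed.

End moderate_deviations.

Theorem theorem3p1 (R : realType) (d : measure_display)
    (Omega : measurableType d) (P : probability Omega R)
    (beta : R) (nu : probability R R) (h : nat -> {RV P >-> R})
    (m : R) (k : nat) (lambda : R) :
  0 < beta ->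
  (\int[nu]_x (x ^+ 2)%:E < +oo)%E ->
  iid_with_law h nu ->
  minimum_of_type (free_energy beta nu) m k lambda ->
  ((2 * height (free_energy beta nu) m)%:E
     / broadness (free_energy beta nu) m ^+ 2 < beta%:E)%E ->
  {ae P, forall w : Omega, exists2 A : R, 0 < A &
    forall a alpha : R, 0 < a < A ->
      1 - (2 * (2 * k%:R - 1))^-1 < alpha < 1 ->
      deviations_principle
        (conditioned_law beta (fun i => h i w) m alpha a)
        (fun n : nat => n%:R `^ (1 - 2 * k%:R * (1 - alpha)))
        (fun x : R => (rate beta k lambda x)%:E)}.
Proof.
move=> beta0 nu2 iid minG _; have [_ k1 lambda0 _] := minG.
have [C [delta [C0 delta0 expansion]]] := minimum_of_type_expansion minG.
have adm : admissible beta k lambda.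
  split=> // k_eq1; apply: (strength_lt_beta beta0 nu2 (m := m)).
  by rewrite -k_eq1.
have Lambda0 := strength_coefficient_gt0 adm.
have := ae_energy_gap_increment m nu2 iid beta0.
apply: filterS => w [N fluctuation].
(* Keeps [t] in the range [|t| <= 1] of the uniform fluctuation bound. *)
pose delta' := Num.min delta 1.
have delta'0 : 0 < delta' by rewrite lt_min delta0 ltr01.
(* [13 = 11 + 2] dominates both constants of the fluctuation bound. *)
have K0 : 0 <= 13 * beta by rewrite mulr_ge0 ?(ltW beta0).
have empirical : empirical_expansion (energy_increment beta (fun i => h i w) m) k
    (strength_coefficient k lambda) C (13 * beta) delta' N.
  move=> n Nn t; rewrite le_min => /andP[t_delta t1].
  have := expansion t t_delta; have := fluctuation n Nn t t1.
  rewrite /energy_gap /energy_increment -/(strength_coefficient k lambda).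
  set E := empirical_energy _ _ _ _; set E0 := empirical_energy _ _ _ _.
  set F := free_energy _ _ _; set F0 := free_energy _ _ _ => fluct expand.
  have -> : E - E0 - strength_coefficient k lambda * t ^+ (2 * k) =
    (F - F0 - strength_coefficient k lambda * t ^+ (2 * k)) + (E - F - (E0 - F0)).
    by ring.
  rewrite (le_trans (ler_normD _ _))// lerD// (le_trans fluct)//.
  have s0 : 0 <= `|t| * fluctuation_scale R n by rewrite mulr_ge0// sqrtr_ge0.
  have i0 : 0 <= n%:R^-1 :> R by rewrite invr_ge0.
  rewrite mulrDr lerD//; last by rewrite ler_wpM2r// ler_wpM2r ?(ltW beta0)// ler_nat.
  by rewrite -mulrA ler_wpM2r// ler_wpM2r ?(ltW beta0)// ler_nat.
(* This radius is the same for all good realizations and all [alpha]; the realization enters only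
   through the threshold [N]. *)
exists (Num.min delta' (strength_coefficient k lambda / (2 * (C + 1)))).
  by rewrite lt_min delta'0 divr_gt0// mulr_gt0// ltr_wpDl// ltW.
move=> a alpha /andP[a0 aA] range.
apply: (conditioned_law_deviations adm (ltW C0) K0 delta'0 _ empirical _ _ a0 (ltW aA)) => //.
- by rewrite ge_min lexx.
- by rewrite ge_min lexx orbT.
Qed.
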